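(* For $Z$ in the Siegel upper half space $\mathbb H_3$ put $$ \begin{array}{ll} w_1=(\tfrac12,0,\tfrac12)^t+Z\,(0,0,\tfrac12)^t, & w_1'=(0,0,\tfrac12)^t+Z\,(0,0,\tfrac12)^t,\\ w_2=(\tfrac12,\tfrac12,0)^t+Z\,(0,\tfrac12,\tfrac12)^t, & w_2'=(0,\tfrac12,0)^t+Z\,(0,\tfrac12,\tfrac12)^t,\\ w_3=(\tfrac12,\tfrac12,\tfrac12)^t+Z\,(0,\tfrac12,0)^t, & w_3'=(0,\tfrac12,\tfrac12)^t+Z\,(0,\tfrac12,0)^t,\\ w_4=(\tfrac12,0,0)^t+Z\,(\tfrac12,\tfrac12,\tfrac12)^t, & w_4'=(0,0,0)^t+Z\,(\tfrac12,\tfrac12,\tfrac12)^t,\\ w_7=(0,0,\tfrac12)^t+Z\,(\tfrac12,\tfrac12,\tfrac12)^t, & w_7'=(\tfrac12,\tfrac12,0)^t+Z\,(\tfrac12,0,\tfrac12)^t. \end{array} $$ Then the following equalities between Jacobian Nullwerte hold for all $Z\in\mathbb H_3$ (every bracket is evaluated at $Z$): $$[w_2,w_3,w_7]\,[w_1,w_3',w_7']=[w_1,w_3,w_7]\,[w_2,w_3',w_7'],$$ $$[w_2',w_3,w_7']\,[w_1',w_3',w_7]=[w_1',w_3,w_7']\,[w_2',w_3',w_7],$$ $$[w_3,w_1,w_2][w_3',w_1,w_2]\,[w_4,w_1,w_2'][w_4',w_1,w_2']=[w_4,w_1,w_2][w_4',w_1,w_2]\,[w_3,w_1,w_2'][w_3',w_1,w_2'],$$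 $$[w_3,w_1,w_2][w_3',w_1,w_2]\,[w_4,w_2,w_1'][w_4',w_2,w_1']=[w_4,w_1,w_2][w_4',w_1,w_2]\,[w_3,w_2,w_1'][w_3',w_2,w_1'],$$ $$[w_3,w_1,w_2][w_3',w_1,w_2]\,[w_4,w_1',w_2'][w_4',w_1',w_2']=[w_4,w_1,w_2][w_4',w_1,w_2]\,[w_3,w_1',w_2'][w_3',w_1',w_2'].$$
   Context: $\mathbb H_3$ is the set of symmetric complex $3\times3$ matrices with positive definite imaginary part. For $w=a+Zb$ with $a,b\in\{0,\tfrac12\}^3$ (column vectors), the theta function with characteristic is $$\theta[w](z;Z)=\sum_{n\in\mathbb Z^3}e^{\pi i\,(n+b)^tZ(n+b)+2\pi i\,(n+b)^t(z+a)},\qquad z\in\mathbb C^3 .$$ For $u_1,u_2,u_3$ of this form, the Jacobian Nullwert is $$[u_1,u_2,u_3]=[u_1,u_2,u_3](Z)=\pi^3\det\left(\frac{\partial\theta[u_i]}{\partial z_j}(0;Z)\right)_{1\le i,j\le3},$$ considered as a function of $Z\in\mathbb H_3$ by fixing the characteristics $(a,b)$ of $u_1,u_2,u_3$ and letting $Z$ vary. *)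

(* Defs.v *)
From HB Require Import structures.
From mathcomp Require Import all_boot all_order all_algebra.
From mathcomp Require Import complex.
From mathcomp Require Import all_classical all_reals all_analysis.
From mathcomp Require Import showcase.summability.
Import Order.TTheory GRing.Theory Num.Theory.
Import numFieldNormedType.Exports.

Set Implicit Arguments.
Unset Strict Implicit.
Unset Printing Implicit Defensive.

Local Open Scope ring_scope.
Local Open Scope complex_scope.

Section JacobianNullwerte.
Variable R : realType.
Local Notation C := R[i].

Definition cexp (z : C) : C :=
  (expR (complex.Re z))%:C * (cos (complex.Im z) +i* sin (complex.Im z)).

Definition siegel_upper_half_space3 (Z : 'M[C]_3) : Prop :=
  Z^T = Z /\
  forall x : 'cV[R]_3, x != 0 ->
    0 < (x^T *m map_mx (@complex.Im R) Z *m x) 0 0.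

Definition col3 (x y z : C) : 'cV[C]_3 := \col_(i < 3) [:: x; y; z]`_i.

(* The point a + Z b is represented by its characteristic (a, b), which stays
   fixed while Z varies. *)
Definition characteristic : Type := 'cV[C]_3 * 'cV[C]_3.

(* [sum] is the unordered sum over 'cV[int]_3, the limit of the partial sums
   along the directed set of finite subsets. *)
Definition theta (w : characteristic) (Z : 'M[C]_3) (z : 'cV[C]_3) : C^o :=
  let: (a, b) := w in
  sum (fun n : 'cV[int]_3 =>
    let m := map_mx intr n + b in
    cexp (pi%:C * 'i%C * (m^T *m Z *m m) 0 0
          + 2 * pi%:C * 'i%C * (m^T *m (z + a)) 0 0) : C^o).

(* The derivatives are complex ones: 'cV[C]_3 and C^o are normed modules
   over C. *)
Definition jacobian_nullwert (u1 u2 u3 : characteristic) (Z : 'M[C]_3) : C :=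
  pi%:C ^+ 3 *
  \det (\matrix_(i < 3, j < 3)
          'D_(delta_mx j 0) (theta (tnth [tuple u1; u2; u3] i) Z) 0).

End JacobianNullwerte.

(* Main.v *)
Require Import Defs.
From mathcomp Require Import all_boot all_order all_algebra.
From mathcomp Require Import finmap complex.
From mathcomp Require Import all_classical all_reals all_analysis.
From mathcomp Require Import showcase.summability.
From mathcomp Require Import zify ring lra.
Import Order.TTheory GRing.Theory Num.Theory.
Import numFieldNormedType.Exports.
Set Implicit Arguments.
Unset Strict Implicit.
Unset Printing Implicit Defensive.
Local Open Scope ring_scope.

(** A Jacobian Nullwert is, up to a factor, the determinant of the gradients at
    0 of three theta functions.  The gradient of an even theta function at 0
    vanishes, and the characteristic of w4' is even; each side of the last
    three identities contains a bracket with w4', so both sides are 0.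

    Write g_i, g_i' for the gradients.  The first identity says that the
    planes spanned by (g_1, g_2), by (g_3, g_7) and by (g_3', g_7') have a line
    in common.  A vector in all three is A g_1 + B g_2, for two products A, B
    of three even theta constants: two instances of Riemann's theta relation
    ([riemann_relation]) have only four terms whose gradient at 0 does not
    vanish, and they express A g_1 + B g_2 through (g_3, g_7) and through
    (g_3', g_7') ([coplanar_w1_w2_w3_w7] and [coplanar_w1_w2_w3'_w7']).  This
    gives B X = 0, where X is the difference of the two sides
    ([concurrent_lines]).

    B may vanish at the given Z, so Z is moved along Z + i t with t >= 0.  In
    terms of q = exp (- pi t / 4) every theta constant and every gradient is a
    power series that converges absolutely for 0 < q <= 1
    ([power_series_grad]).  The lowest coefficients of the factors of B do not
    vanish, so B is nonzero for small q; there X = 0, hence all the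
    coefficients of X are 0, and so is its value at q = 1, that is at Z
    ([power_series_identity], [jac_identity]).

    The second identity is the first one at Z - E_11: the translation changes
    the first bit of a in w1, w2, w3, w3', fixes w7 and w7', and multiplies the
    theta functions by roots of unity that cancel ([jac_identity']).

    Riemann's relation is proved for the quadruple product of theta series as a
    sum over four lattice vectors x_1, ..., x_4: the reflection x_i -> s - x_i
    with s = (x_1 + ... + x_4) / 2 preserves the sum of the x_i and the sum of
    the values of the quadratic form, permutes the indices, and changes the
    sign of every term. *)

(** * Unordered sums *)

Section UnorderedSums.
Variable K : numFieldType.
Implicit Types T U : choiceType.

(** Convergence along finite subsets, written with duplicate-free sequences:
    images, concatenations and products of index sets are then list
    operations. *)
Definition has_sum T (f : T -> K) (s : K) := forall e : K, 0 < e ->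
  exists F : seq T, forall G : seq T, uniq G -> {subset F <= G} ->
    `|\sum_(x <- G) f x - s| <= e.

Definition abs_le T (f : T -> K) (M : K) :=
  forall F : seq T, uniq F -> \sum_(x <- F) `|f x| <= M.

Definition abs_summable T (f : T -> K) := exists M, abs_le f M.

Lemma has_sum_approx T (f : T -> K) s (e : K) (F : seq T) : has_sum f s -> 0 < e ->
  exists G, [/\ uniq G, {subset F <= G} & `|\sum_(x <- G) f x - s| <= e].
Proof.
move=> fs e0; have [F' F'P] := fs _ e0.
exists (undup (F ++ F')); split; first exact: undup_uniq.
  by move=> x xF; rewrite mem_undup mem_cat xF.
apply: F'P => [|x xF]; first exact: undup_uniq.
by rewrite mem_undup mem_cat xF orbT.
Qed.

Lemma le_all_eps (x : K) : (forall e, 0 < e -> `|x| <= e) -> x = 0.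
Proof.
move=> h; apply/eqP; rewrite -normr_le0; apply/negPn/negP => xN.
have x0 : 0 < `|x|.
  rewrite normr_gt0; apply/negP => /eqP x0; move: xN.
  by rewrite x0 normr0 lexx.
have := h (`|x| / 2); rewrite divr_gt0// => /(_ isT).
by rewrite ler_pdivlMr// mulr_natr mulr2n gerDl => x1; case/negP: xN.
Qed.

(** A finite set can be enlarged so as to be good for both sums. *)
Lemma has_sum_unique T (f : T -> K) s t : has_sum f s -> has_sum f t -> s = t.
Proof.
move=> fs ft; apply/eqP; rewrite -subr_eq0; apply/eqP/le_all_eps => e e0.
have e2 : 0 < e / 2 by rewrite divr_gt0.
have [F FP] := fs _ e2.
have [G [uG FG Gt]] := has_sum_approx F ft e2.
have Gs := FP _ uG FG.
rewrite (_ : s - t = (\sum_(x <- G) f x - t) - (\sum_(x <- G) f x - s)); last by ring.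
by apply: (le_trans (ler_normB _ _)); rewrite [leRHS](splitr e) lerD.
Qed.

Lemma has_sumD T (f g : T -> K) s t : has_sum f s -> has_sum g t ->
  has_sum (fun x => f x + g x) (s + t).
Proof.
move=> fs gt e e0; have e2 : 0 < e / 2 by rewrite divr_gt0.
have [F FP] := fs _ e2; have [G GP] := gt _ e2.
exists (F ++ G) => H uH FGH.
rewrite big_split/= (_ : _ - _ = (\sum_(x <- H) f x - s) + (\sum_(x <- H) g x - t));
  last by ring.
apply: (le_trans (ler_normD _ _)); rewrite [leRHS](splitr e) lerD//.
  by apply: FP => // x xF; apply: FGH; rewrite mem_cat xF.
by apply: GP => // x xF; apply: FGH; rewrite mem_cat xF orbT.
Qed.

Lemma has_sum0 T : has_sum (fun _ : T => 0) 0.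
Proof.
move=> e e0; exists [::] => G _ _.
by rewrite big1_eq subrr normr0 ltW.
Qed.

Lemma has_sumZ T (f : T -> K) c s : has_sum f s -> has_sum (fun x => c * f x) (c * s).
Proof.
have [->|c0] := eqVneq c 0.
  move=> _; rewrite mul0r (_ : (fun _ => _) = (fun=> 0)); first exact: has_sum0.
  by apply/funext => x; rewrite mul0r.
move=> fs e e0; have ec : 0 < e / `|c| by rewrite divr_gt0// normr_gt0.
have [F FP] := fs _ ec; exists F => G uG FG.
rewrite -mulr_sumr -mulrBr normrM mulrC -ler_pdivlMr ?normr_gt0//.
exact: FP.
Qed.

Lemma has_sum_big T (I : Type) (r : seq I) (f : I -> T -> K) (s : I -> K) :
  (forall i, has_sum (f i) (s i)) ->
  has_sum (fun x => \sum_(i <- r) f i x) (\sum_(i <- r) s i).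
Proof.
move=> fs; elim: r => [|i r IH].
  rewrite big_nil (_ : (fun _ => _) = (fun=> 0)); first exact: has_sum0.
  by apply/funext => x; rewrite big_nil.
rewrite big_cons (_ : (fun _ => _) = (fun x => f i x + \sum_(j <- r) f j x)).
  exact: has_sumD.
by apply/funext => x; rewrite big_cons.
Qed.

Lemma has_sum_bij T U (f : U -> K) s (phi : T -> U) (psi : U -> T) :
  cancel phi psi -> cancel psi phi -> has_sum f s -> has_sum (f \o phi) s.
Proof.
move=> phiK psiK fs e e0; have [F FP] := fs _ e0.
exists (map psi F) => G uG FG.
rewrite -(big_map phi xpredT f); apply: FP.
  by rewrite map_inj_uniq//; exact: can_inj phiK.
move=> x xF; rewrite -(psiK x); apply/map_f/FG/map_f/xF.
Qed.

Lemma has_sum_le T (f : T -> K) s M : abs_le f M -> has_sum f s -> `|s| <= M.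
Proof.
move=> fM fs.
have M0 : 0 <= M by have := fM [::] isT; rewrite big_nil.
rewrite real_leNgt ?normr_real ?ger0_real//.
apply/negP => Ms; have e0 : 0 < (`|s| - M) / 2 by rewrite divr_gt0// subr_gt0.
have [G [uG _ Gs]] := has_sum_approx [::] fs e0.
have : `|s| <= M + (`|s| - M) / 2.
  rewrite -{1}(subrK (\sum_(x <- G) f x) s) addrC.
  apply: (le_trans (ler_normD _ _)); rewrite lerD//; last by rewrite distrC.
  by apply: le_trans (fM _ uG); exact: ler_norm_sum.
by rewrite -lerBlDl ler_pdivlMr// mulr_natr mulr2n gerDl subr_le0 => /le_gtF; rewrite Ms.
Qed.

Lemma ler_sum_subset T (f : T -> K) (F G : seq T) : (forall x, 0 <= f x) ->
  uniq F -> uniq G -> {subset F <= G} ->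
  \sum_(x <- F) f x <= \sum_(x <- G) f x.
Proof.
move=> f0 uF uG FG.
rewrite [leRHS](bigID [pred x | x \in F])/=.
rewrite -[X in X + _]big_filter [X in _ <= X + _](perm_big F)/=; last first.
  apply: uniq_perm => //; first exact: filter_uniq.
  by move=> x; rewrite mem_filter; case: (boolP (x \in F)) => // /FG ->.
by rewrite lerDl sumr_ge0.
Qed.

Lemma abs_summable_le T (f g : T -> K) : (forall x, `|f x| <= `|g x|) ->
  abs_summable g -> abs_summable f.
Proof.
move=> fg [M gM]; exists M => F uF; apply: le_trans (gM _ uF).
by apply: ler_sum => x _.
Qed.

Lemma abs_summableZ T (f : T -> K) c : abs_summable f -> abs_summable (fun x => c * f x).
Proof.
move=> [M fM]; exists (`|c| * M) => F uF.
under eq_bigr do rewrite normrM.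
by rewrite -mulr_sumr ler_wpM2l// fM.
Qed.

Lemma abs_summableD T (f g : T -> K) : abs_summable f -> abs_summable g ->
  abs_summable (fun x => f x + g x).
Proof.
move=> [M fM] [N gN]; exists (M + N) => F uF.
apply: le_trans (lerD (fM _ uF) (gN _ uF)).
by rewrite -big_split/=; apply: ler_sum => x _; exact: ler_normD.
Qed.

Lemma abs_summable_inj T U (f : U -> K) (phi : T -> U) : injective phi ->
  abs_summable f -> abs_summable (f \o phi).
Proof.
move=> phiI [M fM]; exists M => F uF.
by rewrite -(big_map phi xpredT (fun x => `|f x|)) fM// map_inj_uniq.
Qed.

Lemma abs_summable_norm T (f : T -> K) : abs_summable f -> abs_summable (fun x => `|f x|).
Proof.
by move=> [M fM]; exists M => F uF; under eq_bigr do rewrite normr_id; exact: fM.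
Qed.

(** A finite set of pairs lies in the rectangle of its two projections. *)
Lemma abs_leM T U (f : T -> K) (g : U -> K) M N : abs_le f M -> abs_le g N ->
  abs_le (fun p : T * U => f p.1 * g p.2) (M * N).
Proof.
move=> fM gN H uH.
pose F := undup (map fst H); pose G := undup (map snd H).
have uF : uniq F by exact: undup_uniq.
have uG : uniq G by exact: undup_uniq.
apply: (@le_trans _ _ (\sum_(p <- [seq (x, y) | x <- F, y <- G]) `|f p.1 * g p.2|)).
  apply: ler_sum_subset => //.
    by apply: allpairs_uniq => // -[x y] [x' y'].
  move=> [x y] xyH; apply/allpairsP; exists (x, y); split => //=.
    by rewrite mem_undup; apply/mapP; exists (x, y).
  by rewrite mem_undup; apply/mapP; exists (x, y).
rewrite big_allpairs/=.
under eq_bigr do under eq_bigr do rewrite normrM.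
under eq_bigr do rewrite -mulr_sumr.
rewrite -mulr_suml ler_pM ?sumr_ge0//; [exact: fM|exact: gN].
Qed.

Lemma abs_summableM T U (f : T -> K) (g : U -> K) : abs_summable f -> abs_summable g ->
  abs_summable (fun p : T * U => f p.1 * g p.2).
Proof. by move=> [M fM] [N gN]; exists (M * N); exact: abs_leM. Qed.

End UnorderedSums.

Section ComplexSums.
Variable R : realType.
Local Notation C := R[i].
Local Open Scope complex_scope.
Implicit Types T U : choiceType.

(** The sum is the supremum of the finite partial sums. *)
Lemma has_sum_nonneg T (g : T -> R) : (forall x, 0 <= g x) -> abs_summable g ->
  exists s, has_sum g s.
Proof.
move=> g0 [M gM].
pose S := [set r | exists2 F : seq T, uniq F & r = \sum_(x <- F) g x]%classic.
have gM' F : uniq F -> \sum_(x <- F) g x <= M.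
  move=> /gM; apply: le_trans; apply: ler_sum => x _; exact: ler_norm.
have hS : has_sup S.
  split; first by exists 0, [::] => //; rewrite big_nil.
  by exists M => _ [F uF ->]; exact: gM'.
exists (sup S) => e e0.
have [_ [F uF ->] Fe] := sup_adherent e0 hS.
exists F => G uG FG.
have FGle := ler_sum_subset g0 uF uG FG.
have GS : \sum_(x <- G) g x <= sup S.
  by apply: sup_upper_bound => //; exists G.
rewrite distrC ger0_norm ?subr_ge0//; lra.
Qed.

(** Positive and negative parts reduce this to nonnegative terms. *)
Lemma has_sum_real T (g : T -> R) : abs_summable g -> exists s, has_sum g s.
Proof.
move=> gs.
have gn := abs_summable_norm gs.
have pos : exists s, has_sum (fun x => 2^-1 * (`|g x| + g x)) s.
  apply: has_sum_nonneg => [x|].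
    by rewrite mulr_ge0// -lerBlDr sub0r -normrN ler_norm.
  exact/abs_summableZ/abs_summableD.
have neg : exists s, has_sum (fun x => 2^-1 * (`|g x| + (-1) * g x)) s.
  apply: has_sum_nonneg => [x|].
    by rewrite mulr_ge0// mulN1r subr_ge0 ler_norm.
  by apply/abs_summableZ/abs_summableD => //; exact: abs_summableZ.
have [s1 h1] := pos; have [s2 h2] := neg.
exists (s1 + (-1) * s2).
have := has_sumD h1 (has_sumZ (-1) h2).
congr (has_sum _ _); apply/funext => x; lra.
Qed.

Lemma norm_realc (x : R) : `|x%:C| = `|x|%:C :> C.
Proof. by rewrite normc_def/= expr0n/= addr0 sqrtr_sqr. Qed.

Lemma has_sum_realc T (g : T -> R) s : has_sum g s ->
  has_sum (fun x => (g x)%:C : C) s%:C.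
Proof.
move=> gs e; rewrite ltcE/= => /andP[/eqP e1 e2].
have [F FP] := gs _ e2; exists F => G uG FG.
have := FP _ uG FG.
by rewrite -rmorph_sum -rmorphB/= norm_realc lecE/= e1 eqxx.
Qed.

Lemma normc_ge_Im (x : C) : `|complex.Im x|%:C <= `|x|.
Proof.
have := normc_ge_Re (x * 'i); rewrite ReiNIm normrN normrM.
by rewrite (normc_def 'i)/= expr0n/= expr1n add0r sqrtr1 mulr1.
Qed.

Lemma abs_summable_Re T (f : T -> C) : abs_summable f ->
  abs_summable (fun x => complex.Re (f x)) /\ abs_summable (fun x => complex.Im (f x)).
Proof.
move=> [M fM]; split; exists (complex.Re M) => F uF.
- suff : (\sum_(x <- F) `|complex.Re (f x)|)%:C <= M by rewrite lecE => /andP[].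
  rewrite rmorph_sum; apply: le_trans (fM _ uF).
  by apply: ler_sum => x _; exact: normc_ge_Re.
- suff : (\sum_(x <- F) `|complex.Im (f x)|)%:C <= M by rewrite lecE => /andP[].
  rewrite rmorph_sum; apply: le_trans (fM _ uF).
  by apply: ler_sum => x _; exact: normc_ge_Im.
Qed.

Lemma abs_summable_has_sum T (f : T -> C) : abs_summable f -> exists s, has_sum f s.
Proof.
move=> /abs_summable_Re[/has_sum_real[s1 h1] /has_sum_real[s2 h2]].
exists (s1%:C + 'i * s2%:C).
have := has_sumD (has_sum_realc h1) (has_sumZ 'i (has_sum_realc h2)).
by congr (has_sum _ _); apply/funext => x; rewrite -complexE.
Qed.

(** The sum over pairs exists by absolute convergence, so it may be evaluated
    along finite rectangles, over which the partial sums factor. *)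
Lemma has_sumM T U (f : T -> C) (g : U -> C) s t :
  abs_summable f -> abs_summable g -> has_sum f s -> has_sum g t ->
  has_sum (fun p : T * U => f p.1 * g p.2) (s * t).
Proof.
move=> fS gS fs gt.
have [r fgr] := abs_summable_has_sum (abs_summableM fS gS).
suff -> : s * t = r by [].
apply/eqP; rewrite -subr_eq0; apply/eqP/le_all_eps => e e0.
(* The error is at most [d + d * 1 + `|s| * d + d * `|t|] if [d <= 1]. *)
pose d := e / (1 + `|s| + `|t| + 1).
have k0 : 0 < 1 + `|s| + `|t| + 1 :> C by rewrite ltr_wpDl// !addr_ge0.
have d0 : 0 < d by rewrite divr_gt0.
pose d' := Num.min d 1.
have d'r : d >=< 1 by apply: real_comparable; rewrite ger0_real// ltW.
have d'0 : 0 < d' by rewrite comparable_lt_min// d0 ltr01.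
have d'd : d' <= d by rewrite comparable_ge_min// lexx.
have d'1 : d' <= 1 by rewrite comparable_ge_min// lexx orbT.
have [H HP] := fgr _ d'0.
have [F [uF HF Fs]] := has_sum_approx (map fst H) fs d'0.
have [G [uG HG Gt]] := has_sum_approx (map snd H) gt d'0.
have := HP [seq (x, y) | x <- F, y <- G].
rewrite big_allpairs/=.
under eq_bigr do rewrite -mulr_sumr.
rewrite -mulr_suml.
set a := \sum_(x <- F) _ in Fs *; set b := \sum_(x <- G) _ in Gt *.
have -> : e = d * (1 + `|s| + `|t| + 1) by rewrite mulfVK// gt_eqF.
have uFG : uniq [seq (x, y) | x <- F, y <- G].
  by apply: allpairs_uniq => // -[x y] [x' y'].
have HFG : {subset H <= [seq (x, y) | x <- F, y <- G]}.
  move=> [x y] xyH; apply/allpairsP; exists (x, y); split => //=.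
    by apply/HF/mapP; exists (x, y).
  by apply/HG/mapP; exists (x, y).
move=> /(_ uFG HFG) ab.
have -> : s * t - r = (a * b - r) - (a - s) * (b - t) - s * (b - t) - (a - s) * t by ring.
apply: (le_trans (ler_normB _ _)); apply: (le_trans (lerD (ler_normB _ _) (lexx _))).
apply: (le_trans (lerD (lerD (ler_normB _ _) (lexx _)) (lexx _))).
rewrite !normrM.
have -> : d * (1 + `|s| + `|t| + 1) = d + d * 1 + `|s| * d + d * `|t| by ring.
apply: lerD; [apply: lerD; [apply: lerD|]|].
- exact: le_trans ab d'd.
- by apply: ler_pM => //; [exact: le_trans Fs d'd|exact: le_trans Gt d'1].
- by apply: ler_wpM2l => //; exact: le_trans Gt d'd.
- by apply: ler_wpM2r => //; exact: le_trans Fs d'd.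
Qed.

(** Grouping by the value of [k].  The grouped series converges absolutely, and
    the two sums agree because a finite union of fibers that contains a large
    finite set is itself close to the total. *)
Lemma has_sum_fibers T (k : T -> nat) (f : T -> C) (s : C) :
  abs_summable f -> has_sum f s ->
  exists x : nat -> C, [/\ forall m, has_sum (fun i => f i * (k i == m)%:R) (x m),
    abs_summable x & has_sum x s].
Proof.
move=> fS fs.
have fmS m : abs_summable (fun i => f i * (k i == m)%:R).
  apply: abs_summable_le fS => i; rewrite normrM.
  by case: (_ == _); rewrite ?normr1 ?mulr1// normr0 mulr0.
have /choice[x xP] m := abs_summable_has_sum (fmS m).
have sumK (G : seq nat) i (c : nat -> C) : uniq G ->
    \sum_(m <- G) c m * (f i * (k i == m)%:R) = f i * (if k i \in G then c (k i) else 0).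
  move=> uG; case: (boolP (k i \in G)) => [kG|kG].
    rewrite (bigD1_seq (k i))//= eqxx mulr1 big1 ?addr0 1?mulrC// => m mk.
    by rewrite eq_sym (negbTE mk) !mulr0.
  rewrite mulr0 big1_seq// => m /= mG; case: eqP => [km|]; last by rewrite !mulr0.
  by move: kG; rewrite km mG.
have xS : abs_summable x.
  have [M fM] := fS; exists M => G uG.
  (* Multiplying [x m] by its conjugate phase turns the sum of the norms into
     the sum of a family on [T]. *)
  pose c m := `|x m| / x m.
  have cx m : `|x m| = c m * x m.
    by rewrite /c; have [->|x0] := eqVneq (x m) 0; rewrite ?normr0 ?mulr0// divfK.
  have c1 m : `|c m| <= 1.
    rewrite /c normrM normr_id normfV.
    by have [->|x0] := eqVneq (x m) 0; rewrite ?normr0 ?mul0r// divff ?normr_eq0.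
  have h := has_sum_big G (fun m => has_sumZ (c m) (xP m)).
  rewrite (eq_bigr _ (fun m _ => cx m)).
  have -> : \sum_(m <- G) c m * x m = `|\sum_(m <- G) c m * x m|.
    by rewrite ger0_norm// sumr_ge0// => m _; rewrite -cx.
  apply: has_sum_le h => F uF; apply: le_trans (fM _ uF); apply: ler_sum => i _.
  rewrite sumK// normrM ler_piMr//; case: ifP => // _.
  by rewrite normr0.
exists x; split => //.
have [t xt] := abs_summable_has_sum xS.
suff -> : s = t by [].
apply/eqP; rewrite -subr_eq0; apply/eqP/le_all_eps => e e0.
have e2 : 0 < e / 2 by rewrite divr_gt0.
have e4 : 0 < e / 2 / 2 by rewrite divr_gt0.
have [F FP] := fs _ e4.
have [G [uG FG Gt]] := has_sum_approx (map k F) xt e2.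
have h := has_sum_big G xP.
have [H [uH FH Hx]] := has_sum_approx F h e4.
have HE : \sum_(i <- H) \sum_(m <- G) f i * (k i == m)%:R = \sum_(i <- [seq i <- H | k i \in G]) f i.
  rewrite big_filter [RHS]big_mkcond/=; apply: eq_bigr => i _.
  rewrite -[RHS]mulr1 -[LHS](eq_bigr _ (fun m _ => mul1r _)) (sumK G i (fun=> 1))//.
  by case: ifP => // _; rewrite mulr0 mul0r.
rewrite HE in Hx.
have FHG : {subset F <= [seq i <- H | k i \in G]}.
  by move=> i iF; rewrite mem_filter FH// FG//; exact: map_f.
have := FP _ (filter_uniq _ uH) FHG.
set a := \sum_(i <- _) f i in Hx *; set b := \sum_(m <- G) x m in Hx Gt *.
move=> ae.
have -> : s - t = (a - b) - (a - s) + (b - t) by ring.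
rewrite [leRHS](splitr e) [X in _ <= X + _](splitr (e / 2)).
apply: (le_trans (ler_normD _ _)); rewrite lerD//.
by apply: (le_trans (ler_normB _ _)); rewrite lerD.
Qed.

(** The limit along finite sets that defines [sum] is the one of [has_sum]. *)
Lemma has_sum_sum T (f : T -> C^o) (s : C^o) : has_sum f s -> sum f = s.
Proof.
move=> fs; have tF := @totally_filter T; apply: cvg_lim => //.
apply/cvgrPdist_le => e e0.
have [F FP] := fs _ e0.
exists [fset x in F]%fset => //= G FG.
rewrite distrC /partial_sum.
rewrite (_ : \sum_(i : G) f (val i) = \sum_(i <- G) f i); last by rewrite big_seq_fsetE.
apply: FP => [|x xF]; first exact: fset_uniq.
by apply: (fsubsetP FG); rewrite inE.
Qed.

End ComplexSums.

(** * Power series in one real variable *)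

Section PowerSeries.
Variable R : realType.
Local Notation C := R[i].
Local Open Scope complex_scope.
Implicit Types T U : choiceType.

Lemma has_sum_delta T (i0 : T) (c : C) : has_sum (fun i => c * (i == i0)%:R) c.
Proof.
move=> e e0; exists [:: i0] => G uG /(_ i0); rewrite inE eqxx => /(_ isT) iG.
rewrite (bigD1_seq i0)//= eqxx mulr1 big1 ?addr0 ?subrr ?normr0 ?ltW// => i ii0.
by rewrite (negbTE ii0) mulr0.
Qed.

Lemma abs_summable_delta T (i0 : T) (c : C) : abs_summable (fun i => c * (i == i0)%:R).
Proof.
exists `|c| => G uG; case: (boolP (i0 \in G)) => iG.
  rewrite (bigD1_seq i0)//= eqxx mulr1 big1 ?addr0// => i ii0.
  by rewrite (negbTE ii0) mulr0 normr0.
rewrite big1_seq ?normr_ge0// => i /= iG'; case: eqP => [ii0|_].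
  by move: iG; rewrite -ii0 iG'.
by rewrite mulr0 normr0.
Qed.

(** The family [f] is the sum over [b] of the Kronecker delta at [b] times
    [f b], so products and finite sums suffice. *)
Lemma has_sum_finite (B : finType) T (f : B -> T -> C) (s : B -> C) :
  (forall b, abs_summable (f b)) -> (forall b, has_sum (f b) (s b)) ->
  has_sum (fun p : B * T => f p.1 p.2) (\sum_b s b).
Proof.
move=> fS fs.
have h b : has_sum (fun p : B * T => 1 * (p.1 == b)%:R * f b p.2) (1 * s b).
  exact: (has_sumM (abs_summable_delta b 1) (fS b) (@has_sum_delta _ b 1) (fs b)).
have := has_sum_big (index_enum B) h.
under eq_bigr do rewrite mul1r.
congr (has_sum _ _); apply/funext => -[b t] /=.
rewrite (bigD1 b)//= eqxx !mul1r big1 ?addr0// => b' bb'.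
by rewrite eq_sym (negbTE bb') mulr0 mul0r.
Qed.

(** Absolute convergence at 1 makes the value at 1 depend on the coefficients,
    hence on the germ at 0. *)
Definition is_power_series (f : R -> C) := exists x : nat -> C, abs_summable x /\
  forall q : R, 0 < q <= 1 -> has_sum (fun k => x k * (q ^+ k)%:C) (f q).

Lemma norm_le_qpow (c : C) (q : R) k : 0 < q <= 1 -> `|c * (q ^+ k)%:C| <= `|c|.
Proof.
move=> /andP[q0 q1]; rewrite normrM ler_piMr// norm_realc lecR.
by rewrite ger0_norm ?exprn_ge0 ?exprn_ile1// ltW.
Qed.

(** Grouping the terms with the same exponent.  The coefficients obtained for
    different [q] agree because the sum of each fiber scales by [q ^+ m]. *)
Lemma power_series_coefs T (c : T -> C) (k : T -> nat) (f : R -> C) : abs_summable c ->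
  (forall q : R, 0 < q <= 1 -> has_sum (fun i => c i * (q ^+ k i)%:C) (f q)) ->
  exists x : nat -> C, [/\ abs_summable x,
    forall q : R, 0 < q <= 1 -> has_sum (fun m => x m * (q ^+ m)%:C) (f q) &
    forall m, has_sum (fun i => c i * (k i == m)%:R) (x m)].
Proof.
move=> cS cf.
have [s cs] := abs_summable_has_sum cS.
have [x [xc xS _]] := has_sum_fibers k cS cs.
exists x; split => // q q01.
have cqS : abs_summable (fun i => c i * (q ^+ k i)%:C).
  by apply: abs_summable_le cS => i; exact: norm_le_qpow.
have [y [yc _ yf]] := has_sum_fibers k cqS (cf q q01).
rewrite (_ : (fun _ => _) = y)//; apply/funext => m.
rewrite mulrC; apply: (has_sum_unique (has_sumZ (q ^+ m)%:C (xc m))).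
have := yc m; congr (has_sum _ _); apply/funext => i.
by case: eqP => [->|_]; rewrite ?mulr0// !mulr1 mulrC.
Qed.

Lemma power_seriesI T (c : T -> C) (k : T -> nat) (f : R -> C) : abs_summable c ->
  (forall q : R, 0 < q <= 1 -> has_sum (fun i => c i * (q ^+ k i)%:C) (f q)) -> is_power_series f.
Proof. by move=> cS /(power_series_coefs cS)[x [xS xf _]]; exists x. Qed.

Lemma power_seriesD f g : is_power_series f -> is_power_series g -> is_power_series (fun q => f q + g q).
Proof.
move=> [x [xS xf]] [y [yS yg]]; exists (fun k => x k + y k).
split=> [|q q01]; first exact: abs_summableD.
have := has_sumD (xf q q01) (yg q q01); congr (has_sum _ _); apply/funext => k.
by rewrite mulrDl.
Qed.

Lemma power_seriesM f g : is_power_series f -> is_power_series g -> is_power_series (fun q => f q * g q).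
Proof.
move=> [x [xS xf]] [y [yS yg]].
apply: (@power_seriesI _ (fun p : nat * nat => x p.1 * y p.2) (fun p => p.1 + p.2)%N).
  exact: abs_summableM.
move=> q q01.
have qS (z : nat -> C) : abs_summable z -> abs_summable (fun k => z k * (q ^+ k)%:C).
  by apply: abs_summable_le => i; exact: norm_le_qpow.
have := has_sumM (qS _ xS) (qS _ yS) (xf q q01) (yg q q01).
congr (has_sum _ _); apply/funext => -[i j] /=.
by rewrite exprD rmorphM/=; ring.
Qed.

Lemma power_series_cst c : is_power_series (fun=> c).
Proof.
exists (fun k => c * (k == 0%N)%:R); split; first exact: abs_summable_delta.
move=> q _; have := @has_sum_delta _ 0%N c; congr (has_sum _ _); apply/funext => k.
by case: eqP => [->|_]; rewrite ?expr0 ?mulr1// !mulr0 mul0r.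
Qed.

(** If the sum is 0, the lowest term is the opposite of the sum of the higher
    ones, each of which carries a factor [q ^+ m.+1]. *)
Lemma lowest_coef_le (x : nat -> C) (M : C) m (q : R) : abs_le x M ->
  (forall k, (k < m)%N -> x k = 0) -> 0 < q <= 1 ->
  has_sum (fun k => x k * (q ^+ k)%:C) 0 -> `|x m| <= q%:C * M.
Proof.
move=> xM xlt /andP[q0 q1] xf.
have h := has_sumD xf (has_sumZ (-1) (@has_sum_delta _ m (x m * (q ^+ m)%:C))).
rewrite add0r in h.
set g := (fun k => _ + _) in h.
have gM : abs_le g ((q ^+ m.+1)%:C * M).
  move=> F uF; rewrite {}/g in h *.
  apply: (@le_trans _ _ (\sum_(k <- F) (q ^+ m.+1)%:C * `|x k|)).
    apply: ler_sum => k _.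
    have [km|km|->] := ltngtP k m.
    - by rewrite xlt// mul0r mulr0 mulr0 addr0 normr0 mulr0.
    - rewrite !mulr0 addr0 normrM mulrC ler_wpM2r// norm_realc lecR.
      rewrite ger0_norm ?exprn_ge0 ?(ltW q0)//.
      by apply: ler_wiXn2l => //; exact: ltW.
    - rewrite mulr1 mulN1r subrr normr0 mulr_ge0// ler0c exprn_ge0// (ltW q0)//.
  by rewrite -mulr_sumr ler_wpM2l ?xM// ler0c exprn_ge0// (ltW q0).
have := has_sum_le gM h.
rewrite mulN1r normrN normrM norm_realc (@ger0_norm _ (q ^+ m)) ?exprn_ge0 ?(ltW q0)//.
have -> : (q ^+ m.+1)%:C * M = (q ^+ m)%:C * (q%:C * M).
  by rewrite exprSr rmorphM/= mulrA.
by rewrite [leLHS]mulrC ler_pM2l// ltcR exprn_gt0.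
Qed.

(** The first nonzero coefficient dominates for small [q]. *)
Lemma power_series_nonzero (x : nat -> C) (f : R -> C) m : abs_summable x ->
  (forall q : R, 0 < q <= 1 -> has_sum (fun k => x k * (q ^+ k)%:C) (f q)) ->
  x m != 0 -> exists2 d : R, 0 < d & forall q, 0 < q < d -> f q != 0.
Proof.
move=> [M xM] xf xm.
have [l xl lmin] := ex_minnP (ex_intro (fun m => x m != 0) m xm).
have xlt k : (k < l)%N -> x k = 0.
  by move=> kl; apply: contraTeq kl => /lmin; rewrite -leqNgt.
have M0 : 0 <= M by have := xM [::] isT; rewrite big_nil.
have ME : M = (complex.Re M)%:C by rewrite RRe_real// ger0_real.
set N := complex.Re M in ME; have N0 : 0 <= N by rewrite -ler0c -ME.
pose r := Num.sqrt (complex.Re (x l) ^+ 2 + complex.Im (x l) ^+ 2).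
have rE : `|x l| = r%:C by rewrite normc_def.
have r0 : 0 < r by rewrite -ltcR -rE normr_gt0.
have N1 : 0 < N + 1 by rewrite ltr_wpDl.
exists (Num.min 1 (r / (N + 1))) => [|q /andP[q0]]; first by rewrite lt_min ltr01 divr_gt0.
rewrite lt_min => /andP[q1 qr]; apply/eqP => fq0.
have q01 : 0 < q <= 1 by rewrite q0 ltW.
have := xf q q01; rewrite fq0 => /(lowest_coef_le xM xlt q01).
rewrite rE ME -rmorphM lecR leNgt => /negP; apply.
move: qr; rewrite ltr_pdivlMr//; apply: le_lt_trans.
by rewrite ler_pM2l// lerDl.
Qed.

Lemma power_series_identity f (d : R) : is_power_series f -> 0 < d -> (forall q, 0 < q < d -> f q = 0) ->
  f 1 = 0.
Proof.
move=> [x [xS xf]] d0 f0.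
suff x0 m : x m = 0.
  have := xf 1; rewrite ltr01 lexx => /(_ isT) h.
  apply: (has_sum_unique h); rewrite (_ : (fun _ => _) = (fun=> 0)); first exact: has_sum0.
  by apply/funext => k; rewrite x0 mul0r.
apply/eqP; apply: contraT => /(power_series_nonzero xS xf)[e e0 fe].
pose q := Num.min d e / 2.
have m0 : 0 < Num.min d e by rewrite lt_min d0.
have q0 : 0 < q by rewrite divr_gt0.
have qm : q < Num.min d e by rewrite /q ltr_pdivrMr// mulr_natr mulr2n ltrDl.
move: qm; rewrite lt_min => /andP[qd qe].
by have := fe q; rewrite f0 ?q0 ?qd// qe eqxx => /(_ isT).
Qed.

End PowerSeries.

(** * The complex exponential *)

Section Exponential.
Variable R : realType.
Local Notation C := R[i].
Local Open Scope complex_scope.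
Implicit Types (x y : R) (z w : C).

Lemma cexpD z w : cexp (z + w) = cexp z * cexp w.
Proof.
case: z w => [x y] [x' y']; rewrite /cexp /= expRD cosD sinD.
by apply/eqP; rewrite eq_complex/=; apply/andP; split; apply/eqP; ring.
Qed.

Lemma cexp0 : cexp 0 = 1 :> C.
Proof. by rewrite /cexp/= expR0 cos0 sin0 mul1r. Qed.

Lemma norm_cis y : `|cos y +i* sin y| = 1 :> C.
Proof. by rewrite normc_def/= cos2Dsin2 sqrtr1. Qed.

Lemma norm_cexp z : `|cexp z| = (expR (complex.Re z))%:C.
Proof. by rewrite /cexp normrM norm_cis mulr1 norm_realc ger0_norm// expR_ge0. Qed.

Lemma cexp_neq0 z : cexp z != 0.
Proof. by rewrite -normr_gt0 norm_cexp ltcR expR_gt0. Qed.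

Lemma cexp_real x : cexp x%:C = (expR x)%:C.
Proof. by rewrite /cexp/= cos0 sin0 mulr1. Qed.

Lemma cexpMn z n : cexp (z *+ n) = cexp z ^+ n.
Proof. by elim: n => [|n IH]; rewrite ?cexp0// mulrS cexpD IH exprS. Qed.

Definition ipi : C := 0 +i* pi.

Lemma cexp_ipi : cexp ipi = -1.
Proof.
by rewrite /cexp/= expR0 cospi sinpi mul1r; apply/eqP; rewrite eq_complex/= oppr0 !eqxx.
Qed.

Lemma cexp_ipi_nat n : cexp (ipi *+ n) = (-1) ^+ n.
Proof. by rewrite cexpMn cexp_ipi. Qed.

Lemma cexpN z : cexp (- z) = (cexp z)^-1.
Proof.
apply: (mulIf (cexp_neq0 z)); rewrite mulVf ?cexp_neq0//.
by rewrite -cexpD addNr cexp0.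
Qed.

Lemma cexp_ipi_int (k : int) : cexp (ipi * k%:~R) = (-1) ^+ `|k|%N.
Proof.
case: k => n; first by rewrite -pmulrn mulr_natr cexp_ipi_nat.
rewrite NegzE mulrNz mulrN cexpN abszN -pmulrn mulr_natr cexp_ipi_nat.
by rewrite -exprVn invrN1.
Qed.

Lemma expR_taylor1 x : `|expR x - 1| <= `|x| * expR `|x|.
Proof.
have [x0|x0] := leP 0 x.
  have := expR_ge1Dx (- x); have := expR_gt0 x; have := expRxMexpNx_1 x.
  have e1 : 1 <= expR x by rewrite -expR0 ler_expR.
  rewrite !ger0_norm ?subr_ge0//; nra.
have e1 : expR x < 1 by rewrite expR_lt1.
have := expR_ge1Dx x.
have : 1 <= expR (- x) by rewrite -expR0 ler_expR; lra.
rewrite ltr0_norm ?subr_lt0// ltr0_norm// => h1 h2; nra.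
Qed.

Lemma expR_taylor2 x : `|expR x - 1 - x| <= `|x| ^+ 2 * expR `|x|.
Proof.
have h0 : 0 <= expR x - 1 - x by have := expR_ge1Dx x; lra.
rewrite ger0_norm//.
have [x0|x0] := leP 0 x.
  have := expR_ge1Dx (- x); have := expR_gt0 x; have := expRxMexpNx_1 x.
  move=> h1 h2 h3; rewrite ger0_norm//.
  have : expR x - 1 <= x * expR x by nra.
  have : 1 <= expR x by rewrite -expR0 ler_expR.
  move=> h4 h5.
  suff : expR x - 1 - x <= x * (expR x - 1) by nra.
  by lra.
have := expR_ge1Dx (- x); have := expRxMexpNx_1 x; have := expR_gt0 x.
rewrite ltr0_norm// => h1 h2 h3.
have h4 : expR x - 1 <= x * expR x by nra.
have h5 : 1 - expR x <= - x by lra.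
have h6 : expR x - 1 - x <= x ^+ 2 by nra.
apply: (le_trans h6); rewrite sqrrN ler_peMr ?sqr_ge0//; lra.
Qed.

Lemma normr_sin_le y : `|sin y| <= `|y|.
Proof.
wlog y0 : y / 0 <= y.
  move=> h; have [|y0] := leP 0 y; first exact: h.
  by rewrite -normrN -sinN -[leRHS]normrN h// oppr_ge0 ltW.
have D c : c \in `]0, y[ -> is_derive c 1 (@sin R) (cos c) by move=> _; exact: is_derive_sin.
have Ct : {within `[0, y], continuous (@sin R)}%classic.
  by apply: continuous_subspaceT => c; exact: continuous_sin.
have [c _ E] := MVT_segment y0 D Ct.
move: E; rewrite sin0 !subr0 => ->.
by rewrite normrM ler_piMl// cos_max.
Qed.

Lemma cos_taylor y : `|cos y - 1| <= `|y| ^+ 2.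
Proof.
have -> : cos y - 1 = - (sin (y / 2) ^+ 2 *+ 2).
  have y2 : y = (y / 2) *+ 2 by rewrite -mulr_natr mulfVK.
  by rewrite {1}y2 cos_mulr2n cos2sin2; ring.
rewrite normrN normrMn normrX.
have := normr_sin_le (y / 2); rewrite normrM (@ger0_norm _ 2^-1)//.
set a := `|sin _| => ha; have a0 : 0 <= a by exact: normr_ge0.
have y0 : 0 <= `|y| by exact: normr_ge0.
nra.
Qed.

Lemma cos_taylor1 y : `|cos y - 1| <= `|y|.
Proof.
have h := cos_taylor y; have h2 : `|cos y - 1| <= 2.
  by rewrite ler_norml; have := cos_le1 y; have := cos_geN1 y; lra.
have y0 : 0 <= `|y| by exact: normr_ge0.
have -> : cos y - 1 = - (sin (y / 2) ^+ 2 *+ 2).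
  have y2 : y = (y / 2) *+ 2 by rewrite -mulr_natr mulfVK.
  by rewrite {1}y2 cos_mulr2n cos2sin2; ring.
rewrite normrN normrMn normrX.
have := normr_sin_le (y / 2); have := sin_max (y / 2).
rewrite normrM (@ger0_norm _ 2^-1)//.
set a := `|sin _| => h1 ha; have a0 : 0 <= a by exact: normr_ge0.
nra.
Qed.

Lemma sin_taylor y : `|sin y - y| <= `|y| ^+ 2.
Proof.
wlog y0 : y / 0 <= y.
  move=> h; have [|y0] := leP 0 y; first exact: h.
  have := h (- y); rewrite normrN sinN -opprD normrN; apply.
  by rewrite oppr_ge0 ltW.
have D c : c \in `]0, y[ -> is_derive c 1 (fun t : R => sin t - t) (cos c - 1).
  by move=> _; apply: is_deriveB.
have Ct : {within `[0, y], continuous (fun t : R => sin t - t)}%classic.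
  by apply: continuous_subspaceT => c; apply: cvgB; [exact: continuous_sin|exact: cvg_id].
have [c /andP[c0 cy] E] := MVT_segment y0 D Ct.
move: E; rewrite sin0 !subr0 => ->.
rewrite normrM expr2; apply: ler_wpM2r => //.
rewrite !bnd_simp in c0 cy.
apply: le_trans (cos_taylor1 c) _.
by rewrite !ger0_norm.
Qed.

(** Over z = x + i y the remainder splits into
    (e^x - 1 - x) + e^x (cos y - 1) + i (e^x - 1) sin y + i (sin y - y),
    and each part is at most |z|^2 exp |z|. *)
Lemma cexp_taylor z : `|cexp z - 1 - z| <= 4 * `|z| ^+ 2 * cexp `|z|.
Proof.
case: z => x y.
set n := `|x +i* y|.
have [r rE] : exists r, n = r%:C.
  by exists (Num.sqrt (x ^+ 2 + y ^+ 2)); rewrite /n normc_def.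
have xr : `|x| <= r by rewrite -lecR -rE; exact: (normc_ge_Re (x +i* y)).
have yr : `|y| <= r by rewrite -lecR -rE; exact: (normc_ge_Im (x +i* y)).
have E1 : expR `|x| <= expR r by rewrite ler_expR.
have r0 : 0 <= r by exact: le_trans (normr_ge0 x) xr.
have e0 := expR_gt0 r.
have e1 : 1 <= expR r by rewrite -expR0 ler_expR.
rewrite rE cexp_real.
have -> : cexp (x +i* y) - 1 - (x +i* y) =
    (expR x - 1 - x)%:C + (expR x * (cos y - 1))%:C +
    'i * ((expR x - 1) * sin y)%:C + 'i * (sin y - y)%:C.
  by rewrite /cexp/=; apply/eqP; rewrite eq_complex/=; apply/andP; split; apply/eqP; ring.
have -> : 4 * r%:C ^+ 2 * (expR r)%:C =
    (r ^+ 2 * expR r)%:C + (r ^+ 2 * expR r)%:C + (r ^+ 2 * expR r)%:C + (r ^+ 2 * expR r)%:C.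
  by rewrite !rmorphM/=; ring.
have i1 : `|'i| = 1 :> C.
  by rewrite normc_def/= expr0n/= expr1n add0r sqrtr1.
have xn := normr_ge0 x; have yn := normr_ge0 y.
have sq (a : R) : 0 <= a -> a <= r -> a ^+ 2 <= r ^+ 2.
  by move=> a0 ar; rewrite ler_sqr.
apply: (le_trans (ler_normD _ _)); apply: lerD; last first.
  rewrite normrM i1 mul1r norm_realc lecR; apply: le_trans (sin_taylor y) _.
  apply: le_trans (sq _ yn yr) _; rewrite ler_peMr// exprn_ge0//.
apply: (le_trans (ler_normD _ _)); apply: lerD; last first.
  rewrite normrM i1 mul1r norm_realc lecR normrM.
  have h1 : `|expR x - 1| <= r * expR r.
    by apply: le_trans (expR_taylor1 x) _; rewrite ler_pM// expR_ge0.
  have h2 : `|sin y| <= r by exact: le_trans (normr_sin_le y) yr.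
  have -> : r ^+ 2 * expR r = r * expR r * r by ring.
  by rewrite ler_pM.
apply: (le_trans (ler_normD _ _)); apply: lerD.
  rewrite norm_realc lecR; apply: le_trans (expR_taylor2 x) _.
  by apply: ler_pM => //; rewrite ?sq ?exprn_ge0 ?expR_ge0.
rewrite norm_realc lecR normrM mulrC; apply: ler_pM => //.
  by apply: le_trans (cos_taylor y) _; exact: sq.
rewrite ger0_norm ?expR_ge0//; apply: le_trans E1; rewrite ler_expR; exact: ler_norm.
Qed.

End Exponential.

(** * First-order expansions *)

Section FirstOrder.
Variable R : realType.
Local Notation C := R[i].
Local Open Scope complex_scope.

(** Differentiability at 0 with a quadratic remainder on the unit disc: this
    form is stable under products by an algebraic estimate. *)
Definition expansion1 (f : C -> C) (d : C) :=
  exists K : C, forall h, `|h| <= 1 -> `|f h - f 0 - h * d| <= K * `|h| ^+ 2.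

Lemma expansion1_ge0 f d : expansion1 f d -> exists2 K : C, 0 <= K &
  forall h, `|h| <= 1 -> `|f h - f 0 - h * d| <= K * `|h| ^+ 2.
Proof.
move=> [K KP]; exists K => //.
have := KP 1; rewrite normr1 lexx expr1n mulr1 => /(_ isT); exact: le_trans.
Qed.

Lemma expansion1D f g d e : expansion1 f d -> expansion1 g e ->
  expansion1 (fun h => f h + g h) (d + e).
Proof.
move=> [K KP] [L LP]; exists (K + L) => h h1.
rewrite mulrDl; apply: le_trans (lerD (KP h h1) (LP h h1)).
by apply: le_trans (ler_normD _ _); rewrite le_eqVlt; apply/orP; left; apply/eqP; congr `|_|; ring.
Qed.

Lemma expansion1_cst c : expansion1 (fun=> c) 0.
Proof. by exists 0 => h _; rewrite mulr0 !subr0 subrr normr0 mul0r. Qed.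

(** Write the remainder of the product as the sum of the remainder of [f]
    times [g h], of [f 0] times the remainder of [g], and of
    [h * d * (g h - g 0)]. *)
Lemma expansion1M f g d e : expansion1 f d -> expansion1 g e ->
  expansion1 (fun h => f h * g h) (d * g 0 + f 0 * e).
Proof.
move=> /expansion1_ge0[K K0 KP] /expansion1_ge0[L L0 LP].
exists (K * (`|g 0| + (`|e| + L)) + `|f 0| * L + `|d| * (`|e| + L)) => h h1.
have h2 : `|h| ^+ 2 <= `|h| by rewrite expr2 ler_piMr.
have gb : `|g h - g 0| <= (`|e| + L) * `|h|.
  rewrite (_ : g h - g 0 = h * e + (g h - g 0 - h * e)); last by ring.
  apply: (le_trans (ler_normD _ _)); rewrite mulrDl lerD//.
    by rewrite normrM mulrC.
  by apply: (le_trans (LP h h1)); rewrite ler_wpM2l.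
have eL : 0 <= `|e| + L by rewrite addr_ge0.
have -> : f h * g h - f 0 * g 0 - h * (d * g 0 + f 0 * e) =
  (f h - f 0 - h * d) * (g 0 + (g h - g 0)) + f 0 * (g h - g 0 - h * e)
   + h * d * (g h - g 0) by ring.
apply: (le_trans (ler_normD _ _)); rewrite [leRHS]mulrDl; apply: lerD; last first.
  rewrite !normrM expr2 (_ : _ * (_ * _) = `|h| * `|d| * ((`|e| + L) * `|h|)); last by ring.
  by rewrite ler_wpM2l// mulr_ge0.
apply: (le_trans (ler_normD _ _)); rewrite [leRHS]mulrDl; apply: lerD; last first.
  by rewrite normrM -mulrA ler_wpM2l// LP.
rewrite normrM mulrAC ler_pM// ?KP//.
apply: (le_trans (ler_normD _ _)); rewrite lerD//.
by apply: (le_trans gb); rewrite ler_piMr.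
Qed.

Lemma expansion1_uniq f d e : expansion1 f d -> expansion1 f e -> d = e.
Proof.
move=> /expansion1_ge0[K K0 KP] /expansion1_ge0[L L0 LP].
apply/eqP; rewrite -subr_eq0; apply/eqP/le_all_eps => r r0.
(* At this [h] the two remainders together are at most [`|h| * r]. *)
pose h : C := r / (r + K + L).
have N0 : 0 < r + K + L by rewrite -addrA ltr_wpDr// addr_ge0.
have h0 : 0 < h by rewrite divr_gt0.
have nh : `|h| = h by rewrite ger0_norm// ltW.
have h1 : `|h| <= 1 by rewrite nh ler_pdivrMr// mul1r -addrA lerDl addr_ge0.
have := lerD (LP h h1) (KP h h1).
rewrite -mulrDl => /(le_trans (ler_normB _ _)).
rewrite (_ : _ - _ = h * (d - e)); last by ring.
rewrite normrM nh expr2 mulrCA ler_pM2l// => /le_trans; apply.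
rewrite mulrC /h mulrAC ler_pdivrMr// ler_wpM2l ?(ltW r0)//.
by rewrite [L + K]addrC -addrA lerDr ltW.
Qed.

(** The difference quotient differs from [d] by at most [K * `|h|]. *)
Lemma expansion1_derive (F : 'cV[C]_3 -> C^o) (v : 'cV[C]_3) (d : C) :
  expansion1 (fun h => F (h *: v)) d -> 'D_v F 0 = d.
Proof.
move=> /expansion1_ge0[K K0 KP]; apply: cvg_lim => //.
apply/cvgrPdist_le => e e0.
have K1 : 0 < K + 1 by rewrite ltr_wpDl.
near=> h.
have h0 : h != 0 by near: h; exact: nbhs_dnbhs_neq.
have h1 : `|h| <= 1.
  near: h; apply: nbhs_dnbhs; apply/nbhs_ballP; exists 1 => //= h.
  by rewrite /ball/= sub0r normrN => /ltW.
have he : `|h| <= e / (K + 1).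
  near: h; apply: nbhs_dnbhs; apply/nbhs_ballP; exists (e / (K + 1)) => /=.
    by rewrite divr_gt0.
  by move=> h; rewrite /ball/= sub0r normrN => /ltW.
have := KP h h1; rewrite scale0r => Kh.
rewrite /= addr0 (_ : _ - _ = - (h^-1 * (F (h *: v) - F 0 - h * d))); last first.
  rewrite [h^-1 *: _](_ : _ = h^-1 * (F (h *: v) - F 0))//.
  by rewrite [X in _ = - X]mulrBr opprB mulKf.
rewrite normrN normrM normfV ler_pdivrMl ?normr_gt0//.
apply: (le_trans Kh); rewrite expr2 mulrCA ler_pM2l ?normr_gt0//.
apply: (@le_trans _ _ ((K + 1) * `|h|)); first by rewrite ler_wpM2r// lerDl.
by rewrite mulrC -ler_pdivlMr.
Unshelve. all: by end_near. Qed.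

Lemma le_abs_summable (T : choiceType) (f g : T -> C) : (forall x, `|f x| <= g x) ->
  abs_summable g -> abs_summable f.
Proof.
move=> fg; apply: abs_summable_le => x; rewrite [leRHS]ger0_norm//.
exact: le_trans (fg x).
Qed.

Lemma cexp_norm_ge1 (z : C) : 1 <= cexp `|z|.
Proof. by rewrite normc_def cexp_real lecR -expR0 ler_expR sqrtr_ge0. Qed.

Lemma cexp_norm_sqr (z : C) : `|z| ^+ 2 <= 2 * cexp `|z|.
Proof.
rewrite normc_def cexp_real; set x := Num.sqrt _.
have x0 : 0 <= x by exact: sqrtr_ge0.
rewrite -rmorphXn (_ : 2 = 2%:C) -?rmorphM ?lecR; last by rewrite rmorph_nat.
have := expR_ge1Dxn 1 x0; rewrite (_ : (2`!)%:R = 2 :> R)//; lra.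
Qed.

(** Termwise differentiation: by [cexp_taylor] the remainder of each term is at
    most 4 |h|^2 |l|^2 exp |l|, and |l|^2 is at most 2 exp |l|. *)
Lemma expansion1_series (T : choiceType) (c l : T -> C) (s : C -> C) (d : C) :
  abs_summable (fun i => c i * cexp `|l i| ^+ 2) ->
  (forall h, has_sum (fun i => c i * cexp (h * l i)) (s h)) ->
  has_sum (fun i => c i * l i) d -> expansion1 s d.
Proof.
move=> [M cM] cs cd; exists (8 * M) => h h1.
have hs : has_sum (fun i => c i * cexp (h * l i) + (-1) * (c i * cexp (0 * l i))
    + (- h) * (c i * l i)) (s h - s 0 - h * d).
  have := has_sumD (has_sumD (cs h) (has_sumZ (-1) (cs 0))) (has_sumZ (- h) cd).
  by rewrite mulN1r mulNr.
apply: has_sum_le hs => F uF.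
apply: (@le_trans _ _ (\sum_(i <- F) 8 * `|h| ^+ 2 * `|c i * cexp `|l i| ^+ 2|)); last first.
  rewrite -mulr_sumr [8 * M * _]mulrAC; apply: ler_wpM2l; first by rewrite mulr_ge0// exprn_ge0.
  exact: cM.
apply: ler_sum => i _; rewrite mul0r cexp0.
have -> : c i * cexp (h * l i) + (-1) * (c i * 1) + (- h) * (c i * l i)
  = c i * (cexp (h * l i) - 1 - h * l i) by ring.
rewrite [leLHS]normrM [in leRHS]normrM [leRHS]mulrCA; apply: ler_wpM2l => //.
apply: (le_trans (cexp_taylor _)).
have e1 := cexp_norm_ge1 (l i).
have e0 : 0 <= cexp `|l i| by exact: le_trans e1.
have hl : cexp `|h * l i| <= cexp `|l i|.
  have : `|h * l i| <= `|l i| by rewrite normrM ler_piMl.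
  by rewrite !normc_def !cexp_real !lecR ler_expR.
rewrite [in leRHS]ger0_norm ?exprn_ge0//.
have sq := cexp_norm_sqr (l i).
have -> : 8 * `|h| ^+ 2 * cexp `|l i| ^+ 2 =
  (4 * (`|h| ^+ 2 * (2 * cexp `|l i|))) * cexp `|l i| by ring.
apply: ler_pM => //.
- by apply: le_trans (cexp_norm_ge1 _).
- by rewrite ler_wpM2l// normrM exprMn ler_wpM2l ?exprn_ge0.
Qed.

End FirstOrder.

(** * Quadratic forms on the lattice *)

Section QuadraticForms.
Variable R : realType.
Local Notation C := R[i].
Local Open Scope complex_scope.
Local Notation lattice := 'cV[int]_3.
Implicit Types (Z : 'M[C]_3) (z : 'cV[C]_3) (x y a b : lattice).

(** The forms below are evaluated at integral vectors, so that the exponents of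
    the theta series become integral combinations of their values. *)
Definition qform Z x y : C := ((map_mx intr x)^T *m Z *m map_mx intr y) 0 0.
Definition pairing x z : C := ((map_mx intr x)^T *m z) 0 0.
Definition dotz a x : int := (a^T *m x) 0 0.

Lemma trmx00 (T : Type) (A : 'M[T]_1) : A 0 0 = A^T 0 0.
Proof. by rewrite mxE. Qed.

Lemma qformDl Z x x' y : qform Z (x + x') y = qform Z x y + qform Z x' y.
Proof. by rewrite /qform map_mxD linearD/= !mulmxDl mxE. Qed.
Lemma qformDr Z x y y' : qform Z x (y + y') = qform Z x y + qform Z x y'.
Proof. by rewrite /qform map_mxD !mulmxDr mxE. Qed.
Lemma qformNl Z x y : qform Z (- x) y = - qform Z x y.
Proof. by rewrite /qform map_mxN linearN/= !mulNmx mxE. Qed.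
Lemma qformNr Z x y : qform Z x (- y) = - qform Z x y.
Proof. by rewrite /qform map_mxN !mulmxN mxE. Qed.
Lemma qformC Z x y : Z^T = Z -> qform Z x y = qform Z y x.
Proof.
by move=> ZT; rewrite /qform trmx00 !trmx_mul trmxK ZT mulmxA.
Qed.
Lemma pairingD x y z : pairing (x + y) z = pairing x z + pairing y z.
Proof. by rewrite /pairing map_mxD linearD/= mulmxDl mxE. Qed.
Lemma pairingN x z : pairing (- x) z = - pairing x z.
Proof. by rewrite /pairing map_mxN linearN/= mulNmx mxE. Qed.
Lemma dotzDr a x y : dotz a (x + y) = dotz a x + dotz a y.
Proof. by rewrite /dotz mulmxDr mxE. Qed.
Lemma dotzDl a b x : dotz (a + b) x = dotz a x + dotz b x.
Proof. by rewrite /dotz linearD/= mulmxDl mxE. Qed.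
Lemma dotzNr a x : dotz a (- x) = - dotz a x.
Proof. by rewrite /dotz mulmxN mxE. Qed.
Lemma dotzC a x : dotz a x = dotz x a.
Proof. by rewrite /dotz trmx00 trmx_mul trmxK. Qed.

Lemma sum3 (V : zmodType) (F : 'I_3 -> V) : \sum_i F i = F 0 + F 1 + F 2%:R.
Proof.
rewrite !big_ord_recl big_ord0 addr0 -!addrA; congr (F _ + (F _ + F _)); exact: val_inj.
Qed.

Lemma qformE Z x y : qform Z x y = \sum_i \sum_j (x i 0)%:~R * Z i j * (y j 0)%:~R.
Proof.
rewrite /qform mxE exchange_big/=; apply: eq_bigr => j _.
by rewrite mxE mulr_suml; apply: eq_bigr => i _; rewrite !mxE.
Qed.
Lemma pairingE x z : pairing x z = \sum_i (x i 0)%:~R * z i 0.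
Proof. by rewrite /pairing mxE; apply: eq_bigr => i _; rewrite !mxE. Qed.
Lemma dotzE a x : dotz a x = \sum_i a i 0 * x i 0.
Proof. by rewrite /dotz mxE; apply: eq_bigr => i _; rewrite !mxE. Qed.

Lemma qform_add_scalar Z (c : C) x :
  qform (Z + c%:M) x x = qform Z x x + c * \sum_i (x i 0)%:~R ^+ 2.
Proof.
rewrite /qform mulmxDr mulmxDl mul_mx_scalar -scalemxAl; set P := _ *m _ *m _.
have -> (Q : 'M[C]_1) : (P + c *: Q) 0 0 = P 0 0 + c * Q 0 0 by rewrite !mxE.
by congr (_ + c * _); rewrite mxE; apply: eq_bigr => i _; rewrite !mxE expr2.
Qed.

(** Let Y u = e_j, so that u_j = u^T Y u > 0.  Positivity of the form at
    x - t u, with t = x_j / u_j, gives x_j^2 <= u_j (x^T Y x). *)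
Lemma posdef_coercive (n : nat) (Y : 'M[R]_n.+1) : Y^T = Y ->
  (forall x : 'cV_n.+1, x != 0 -> 0 < (x^T *m Y *m x) 0 0) ->
  exists2 d, 0 < d & forall (x : 'cV_n.+1) j, d * x j 0 ^+ 2 <= (x^T *m Y *m x) 0 0.
Proof.
move=> YT pos.
have pos0 (x : 'cV_n.+1) : 0 <= (x^T *m Y *m x) 0 0.
  have [->|/pos/ltW//] := eqVneq x 0; by rewrite mulmx0 mxE.
have Yu : Y \in unitmx.
  rewrite unitmxE unitfE; apply/negP => /det0P[v v0 vY].
  have := pos v^T; rewrite trmxK vY mul0mx mxE ltxx => /(_ _)/negP; apply => //.
  by apply: contra_neq v0 => /(congr1 trmx); rewrite trmxK trmx0.
pose e (j : 'I_n.+1) : 'cV[R]_n.+1 := delta_mx j 0.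
pose u j := invmx Y *m e j.
have Yuj j : Y *m u j = e j by rewrite /u mulmxA mulmxV// mul1mx.
have xe (x : 'cV_n.+1) j : (x^T *m e j) 0 0 = x j 0.
  rewrite mxE (bigD1 j)//= !mxE !eqxx mulr1 big1 ?addr0// => i ij.
  by rewrite !mxE (negbTE ij) mulr0.
have ex (x : 'cV_n.+1) j : ((e j)^T *m x) 0 0 = x j 0.
  by rewrite -[RHS]xe [RHS]trmx00 trmx_mul trmxK.
have uY j : (u j)^T *m Y = (e j)^T by rewrite -{1}YT -trmx_mul Yuj.
have uj0 j : 0 < (u j) j 0.
  rewrite -ex -uY; apply: pos; apply/eqP => u0; have := Yuj j.
  rewrite u0 mulmx0 => /matrixP/(_ j 0); rewrite !mxE !eqxx/= => /esym/eqP.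
  by rewrite oner_eq0.
have key (x : 'cV_n.+1) j : (x j 0) ^+ 2 <= (u j) j 0 * (x^T *m Y *m x) 0 0.
  set w := (u j) j 0; have w0 : 0 < w by exact: uj0.
  pose t := x j 0 / w.
  have := pos0 (x - t *: u j).
  have -> : ((x - t *: u j)^T *m Y *m (x - t *: u j)) 0 0 =
      (x^T *m Y *m x) 0 0 - t * x j 0 - t * (x j 0 - t * w).
    have E : (x - t *: u j)^T *m Y = x^T *m Y - t *: (e j)^T.
      by rewrite linearB/= linearZ/= mulmxBl -scalemxAl uY.
    rewrite E mulmxBl [X in X - _]mulmxBr [X in _ - X]mulmxBr -!scalemxAl -!scalemxAr.
    rewrite -[x^T *m Y *m u j]mulmxA Yuj.
    have mB (A B : 'M[R]_1) : (A - B) 0 0 = A 0 0 - B 0 0 by rewrite !mxE.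
    have mZ c (A : 'M[R]_1) : (c *: A) 0 0 = c * A 0 0 by rewrite mxE.
    by rewrite !(mB, mZ) xe !ex -/w; ring.
  have -> : t * w = x j 0 by rewrite /t divfK// gt_eqF.
  rewrite subrr mulr0 subr0 subr_ge0 /t mulrAC ler_pdivrMr// mulrC -expr2.
  by rewrite [leRHS]mulrC.
exists (\sum_j (u j) j 0)^-1.
  by rewrite invr_gt0 (bigD1 0)//= ltr_pwDl// sumr_ge0// => i _; rewrite ltW.
have s0 : 0 < \sum_j (u j) j 0.
  by rewrite (bigD1 0)//= ltr_pwDl// sumr_ge0// => i _; rewrite ltW.
move=> x j; rewrite ler_pdivrMl//; apply: (le_trans (key x j)).
apply: ler_wpM2r => //; rewrite (bigD1 j)//= lerDl sumr_ge0// => i _; exact/ltW.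
Qed.

End QuadraticForms.

(** * Theta series *)

Section Theta.
Variable R : realType.
Local Notation C := R[i].
Local Open Scope complex_scope.
Local Notation lattice := 'cV[int]_3.
Implicit Types (Z : 'M[C]_3) (z : 'cV[C]_3) (x y a b n : lattice).

(** The logarithm of a term of the theta series with characteristic
    (a / 2, b / 2), as a function of x = 2 (n + b / 2). *)
Definition phase Z a z x : C :=
  ipi R * (qform Z x x / 4 + pairing x z + (dotz a x)%:~R / 2).

Definition theta_term Z a b z n : C := cexp (phase Z a z (n *+ 2 + b)).

(** Here [a] and [b] are twice the entries of the characteristic.  They may be
    any integral vectors, which leaves room for periods. *)
Definition theta_int Z a b z : C := sum (theta_term Z a b z : lattice -> C^o).

Definition theta_grad Z a b (j : 'I_3) : C :=
  sum ((fun n => theta_term Z a b 0 n * (ipi R * ((n *+ 2 + b) j 0)%:~R)) : lattice -> C^o).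

Definition halfchar a : 'cV[C]_3 := map_mx (fun k : int => k%:~R / 2) a.

Lemma theta_halfchar Z a b z : theta (halfchar a, halfchar b) Z z = theta_int Z a b z.
Proof.
rewrite /theta /theta_int; congr sum; apply/funext => n; congr cexp.
set x := n *+ 2 + b.
have -> : map_mx intr n + halfchar b = 2^-1 *: map_mx intr x.
  by apply/matrixP => i j; rewrite !mxE mulr2n !intrD; field.
have m00 (c : C) (A : 'M[C]_1) : (c *: A) 0 0 = c * A 0 0 by rewrite mxE.
have D00 (A B : 'M[C]_1) : (A + B) 0 0 = A 0 0 + B 0 0 by rewrite mxE.
have ax : ((map_mx intr x)^T *m halfchar a) 0 0 = (dotz a x)%:~R / 2.
  rewrite dotzE (rmorph_sum (intmul 1)) mulr_suml mxE; apply: eq_bigr => i _.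
  by rewrite !mxE (rmorphM (intmul (1 : C)))/=; ring.
have tZ (c : C) (A : 'cV[C]_3) : (c *: A)^T = c *: A^T by rewrite linearZ.
rewrite tZ -!scalemxAl -scalemxAr mulmxDr !m00 D00 ax.
rewrite -[((map_mx intr x)^T *m z) 0 0]/(pairing x z).
rewrite -[((map_mx intr x)^T *m Z *m map_mx intr x) 0 0]/(qform Z x x) /phase.
have -> : ipi R = pi%:C * 'i%C by apply/eqP; rewrite eq_complex/=; apply/andP; split; apply/eqP; ring.
by field.
Qed.

(** An integer is determined by its sign and its absolute value. *)
Lemma abs_summable_geometric (r : R) : 0 <= r < 1 ->
  abs_summable (fun k : int => (r ^+ `|k|)%:C : C).
Proof.
move=> /andP[r0 r1].
have natS : abs_summable (fun k : nat => (r ^+ k)%:C : C).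
  exists ((1 - r)^-1)%:C => F uF.
  have [N FG] : exists N, {subset F <= index_iota 0 N}.
    exists (\max_(i <- F) i).+1 => i iF; rewrite mem_index_iota/= ltnS.
    by rewrite (big_rem i)//= leq_maxl.
  have uG : uniq (index_iota 0 N) by exact: iota_uniq.
  apply: (le_trans (ler_sum_subset _ uF uG FG)) => //.
  under eq_bigr do rewrite norm_realc ger0_norm ?exprn_ge0//.
  rewrite -(rmorph_sum (real_complex R)) lecR.
  rewrite big_mkord -[leRHS]mul1r ler_pdivlMr ?subr_gt0//.
  have /(congr1 -%R) := subrX1 r N.
  rewrite -mulNr !opprB mulrC => <-.
  by rewrite gerBl exprn_ge0.
have boolS : abs_summable (fun b : bool => 1 : C).
  exists 2%:R => F uF; rewrite big_const_seq count_predT iter_addr_0 normr1 ler_nat.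
  by rewrite -card_bool -(card_uniqP uF) max_card.
have phi_inj : injective (fun k : int => (0 <= k, `|k|%N)).
  move=> k l [kl1 kl2]; move: kl1.
  have [k0|k0] := leP 0 k => /esym.
    by move=> l0; rewrite -(gez0_abs k0) -(gez0_abs l0) kl2.
  move=> /negbT; rewrite -ltNge => l0.
  by apply: oppr_inj; rewrite -(ltz0_abs k0) -(ltz0_abs l0) kl2.
have := abs_summable_inj phi_inj (abs_summableM boolS natS).
by congr abs_summable; apply/funext => k /=; rewrite mul1r.
Qed.

Lemma Im_sum I (r : seq I) (F : I -> C) :
  complex.Im (\sum_(i <- r) F i) = \sum_(i <- r) complex.Im (F i).
Proof. by apply: (big_morph _ (id1 := 0)) => // -[? ?] [? ?]. Qed.

Lemma Im_intMl (k : int) (w : C) : complex.Im (k%:~R * w) = k%:~R * complex.Im w.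
Proof. by rewrite -(rmorph_int (real_complex R)); case: w => u v /=; rewrite mul0r addr0. Qed.

Lemma Im_qform Z x : complex.Im (qform Z x x) =
  ((map_mx intr x)^T *m map_mx (@complex.Im R) Z *m map_mx intr x) 0 0.
Proof.
rewrite qformE mxE exchange_big Im_sum/=; apply: eq_bigr => j _.
rewrite mxE mulr_suml Im_sum; apply: eq_bigr => i _.
by rewrite !mxE mulrC Im_intMl Im_intMl mulrC.
Qed.

Lemma Im_pairing x z : complex.Im (pairing x z) = \sum_i (x i 0)%:~R * complex.Im (z i 0).
Proof. by rewrite pairingE Im_sum; apply: eq_bigr => i _; rewrite Im_intMl. Qed.

Lemma Re_phase Z a z x : complex.Re (phase Z a z x) =
  - (pi * (complex.Im (qform Z x x) / 4 + complex.Im (pairing x z))).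
Proof.
rewrite /phase /ipi.
have -> : (dotz a x)%:~R / 2 = ((dotz a x)%:~R / 2)%:C :> C.
  by rewrite rmorphM/= rmorph_int fmorphV rmorph_nat.
have -> : qform Z x x / 4 = qform Z x x * (4^-1)%:C by rewrite fmorphV rmorph_nat.
by case: (qform _ _ _) => u v; case: (pairing _ _) => s t /=; ring.
Qed.

Definition norm1 x : R := \sum_i `|(x i 0)%:~R|.

(** The imaginary part of Z dominates a multiple of the sum of squares, so each
    coordinate contributes a Gaussian, which is at most a constant times
    exp (- |n_j|).  The weight [expR (r * _)] is what termwise differentiation
    uses up. *)
Lemma theta_summable Z a b z (r : R) : siegel_upper_half_space3 Z ->
  abs_summable (fun n => theta_term Z a b z n * (expR (r * norm1 (n *+ 2 + b)))%:C).
Proof.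
move=> [ZT Zpos].
have [] := @posdef_coercive R 2 (map_mx (@complex.Im R) Z) _ Zpos.
  by rewrite map_trmx ZT.
move=> d d0 dP.
pose al : R := pi * d / 12.
have al0 : 0 < al by rewrite divr_gt0// mulr_gt0// pi_gt0.
pose rho j : R := pi * `|complex.Im (z j 0)| + `|r|.
pose K (j : 'I_3) : R := (rho j + 1) ^+ 2 / (4 * al) + `|(b j 0)%:~R|.
pose g (k : int) : C := (expR (-1) ^+ `|k|)%:C.
have gS : abs_summable g.
  by apply: abs_summable_geometric; rewrite expR_ge0 expR_lt1 ltrN10.
pose c : C := (expR (\sum_j K j))%:C.
have GS := abs_summableZ c (abs_summableM (abs_summableM gS gS) gS).
have phi_inj : injective (fun n => (n 0 0, n 1 0, n 2%:R 0)).
  move=> m n [e0 e1 e2]; apply/matrixP => i j; rewrite ord1.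
  by have [] : [\/ i = 0, i = 1 | i = 2%:R];
    [case: i => -[|[|[|//]]] /= ?; [apply: Or31|apply: Or32|apply: Or33]; exact: val_inj
    | move=> -> ..].
apply: le_abs_summable (abs_summable_inj phi_inj GS) => n /=.
rewrite normrM norm_cexp norm_realc (@ger0_norm _ (expR _)) ?expR_ge0// -rmorphM/= -expRD.
rewrite /g /c -!rmorphM/= lecR -!expRM_natl -!expRD ler_expR.
set x := n *+ 2 + b.
rewrite Re_phase Im_qform Im_pairing.
set q := (_ *m _ *m _) 0 0.
have qP : \sum_j (d / 3) * (x j 0)%:~R ^+ 2 <= q.
  rewrite sum3; have := dP (map_mx intr x) 0; have := dP (map_mx intr x) 1.
  have := dP (map_mx intr x) 2%:R; rewrite -/q !mxE; lra.
have key j : - (al * (x j 0)%:~R ^+ 2) - pi * ((x j 0)%:~R * complex.Im (z j 0))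
    + r * `|(x j 0)%:~R| <= K j - (absz (n j 0))%:R.
  set X : R := (x j 0)%:~R; set w := complex.Im _.
  have h1 : - (pi * (X * w)) <= pi * `|w| * `|X|.
    rewrite -mulrN -mulrA ler_wpM2l// ?pi_ge0//.
    by apply: le_trans (ler_norm _) _; rewrite normrN normrM mulrC.
  have h2 : r * `|X| <= `|r| * `|X| by rewrite ler_wpM2r// ler_norm.
  have h3 : (absz (n j 0))%:R <= `|X| + `|(b j 0)%:~R|.
    rewrite natr_absz intr_norm.
    have := ler_normB X (b j 0)%:~R.
    rewrite (_ : X - _ = (n j 0)%:~R *+ 2); last by rewrite /X /x !mxE intrD mulr2n intrD; ring.
    rewrite normrMn; have := normr_ge0 ((n j 0)%:~R : R); lra.
  have h4 : - (al * X ^+ 2) + (rho j + 1) * `|X| <= (rho j + 1) ^+ 2 / (4 * al).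
    have al4 : 0 < 4 * al by rewrite mulr_gt0.
    rewrite -(@real_normK _ X) ?num_real// ler_pdivlMr//.
    have := sqr_ge0 (rho j + 1 - 2 * al * `|X|); lra.
  rewrite /K; rewrite /rho in h4 *; lra.
have := key 0; have := key 1; have := key 2%:R.
have := ler_wpM2l (pi_ge0 R) qP.
rewrite /norm1 !sum3 /al; lra.
Qed.

Lemma abs_summable_theta_term Z a b z : siegel_upper_half_space3 Z ->
  abs_summable (theta_term Z a b z).
Proof.
move=> /(theta_summable a b z 0); congr abs_summable; apply/funext => n.
by rewrite mul0r expR0 mulr1.
Qed.

Lemma theta_int_has_sum Z a b z : siegel_upper_half_space3 Z ->
  has_sum (theta_term Z a b z) (theta_int Z a b z).
Proof.
move=> hZ; have [s hs] := abs_summable_has_sum (abs_summable_theta_term a b z hZ).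
by rewrite /theta_int (has_sum_sum hs).
Qed.

Lemma norm1_ge x (j : 'I_3) : `|(x j 0)%:~R| <= norm1 x.
Proof. by rewrite /norm1 (bigD1 j)//= lerDl sumr_ge0. Qed.

Lemma norm_ipi : `|ipi R| = pi%:C.
Proof. by rewrite /ipi normc_def/= expr0n/= add0r sqrtr_sqr ger0_norm// pi_ge0. Qed.

Lemma norm_ipiM (k : int) : `|ipi R * k%:~R| = (pi * `|k%:~R|)%:C.
Proof. by rewrite normrM norm_ipi -(rmorph_int (real_complex R)) norm_realc rmorphM. Qed.

Lemma abs_summable_theta_grad Z a b j : siegel_upper_half_space3 Z ->
  abs_summable (fun n => theta_term Z a b 0 n * (ipi R * ((n *+ 2 + b) j 0)%:~R)).
Proof.
move=> /(theta_summable a b 0 pi); apply: abs_summable_le => n.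
rewrite !normrM ler_wpM2l// -normrM norm_ipiM norm_realc lecR (@ger0_norm _ (expR _)) ?expR_ge0//.
apply: (@le_trans _ _ (pi * norm1 (n *+ 2 + b))).
  by apply: ler_wpM2l; [exact: pi_ge0|exact: norm1_ge].
by have := expR_ge1Dx (pi * norm1 (n *+ 2 + b)); lra.
Qed.

Lemma theta_grad_has_sum Z a b j : siegel_upper_half_space3 Z ->
  has_sum (fun n => theta_term Z a b 0 n * (ipi R * ((n *+ 2 + b) j 0)%:~R))
    (theta_grad Z a b j).
Proof.
move=> hZ; have [s hs] := abs_summable_has_sum (abs_summable_theta_grad a b j hZ).
by rewrite /theta_grad (has_sum_sum hs).
Qed.

Lemma pairing_delta x j (h : C) : pairing x (h *: delta_mx j 0) = h * (x j 0)%:~R.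
Proof.
rewrite pairingE (bigD1 j)//= !mxE !eqxx mulr1 big1 ?addr0 1?mulrC// => i ij.
by rewrite !mxE (negbTE ij) !mulr0.
Qed.

Lemma pairing0 x : pairing x 0 = 0 :> C.
Proof. by rewrite /pairing mulmx0 mxE. Qed.

(** The derivative in the direction of the j-th coordinate multiplies the term
    at x by pi i x_j. *)
Lemma theta_expansion Z a b j : siegel_upper_half_space3 Z ->
  expansion1 (fun h => theta_int Z a b (h *: delta_mx j 0)) (theta_grad Z a b j).
Proof.
move=> hZ.
apply: (@expansion1_series _ _ (theta_term Z a b 0)
    (fun n => ipi R * ((n *+ 2 + b) j 0)%:~R)); last exact: theta_grad_has_sum.
- have := theta_summable a b 0 (pi *+ 2) hZ; apply: abs_summable_le => n.
  rewrite norm_ipiM cexp_real -rmorphXn [leLHS]normrM [leRHS]normrM ler_wpM2l//.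
  rewrite !norm_realc lecR/=.
  rewrite (@ger0_norm _ (_ ^+ 2)) ?exprn_ge0 ?expR_ge0// (@ger0_norm _ (expR _)) ?expR_ge0//.
  rewrite -expRM_natl ler_expR.
  by have := ler_wpM2l (pi_ge0 R) (norm1_ge (n *+ 2 + b) j); lra.
move=> h; have := theta_int_has_sum a b (h *: delta_mx j 0) hZ.
congr (has_sum _ _); apply/funext => n; rewrite /theta_term -cexpD; congr cexp.
by rewrite /phase pairing_delta pairing0; ring.
Qed.

End Theta.

(** * Parity, periods and translations *)

(* Identities between integer combinations of lattice vectors, entry by entry. *)
Ltac lattice_eq := apply/matrixP => ? ?; rewrite ?mulr2n !mxE; ring.

Section Transformations.
Variable R : realType.
Local Notation C := R[i].
Local Open Scope complex_scope.
Local Notation lattice := 'cV[int]_3.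
Implicit Types (Z : 'M[C]_3) (z : 'cV[C]_3) (x y a b n : lattice) (S : 'M[int]_3).

(** The powers of exp (pi i / 4): every constant in the transformation formulas
    is one of them. *)
Definition zeta8 (k : int) : C := cexp (ipi R * (k%:~R / 4)).

Lemma zeta8D j k : zeta8 (j + k) = zeta8 j * zeta8 k.
Proof. by rewrite /zeta8 -cexpD intrD; congr cexp; ring. Qed.

Lemma zeta8_0 : zeta8 0 = 1.
Proof. by rewrite /zeta8 mul0r mulr0 cexp0. Qed.

Lemma zeta8_neq0 k : zeta8 k != 0.
Proof. exact: cexp_neq0. Qed.

Lemma zeta8_mul4 k : zeta8 (4 * k) = (-1) ^+ `|k|%N.
Proof. by rewrite -cexp_ipi_int /zeta8 intrM; congr cexp; field. Qed.

Lemma zeta8_mul8 k : zeta8 (8 * k) = 1.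
Proof.
rewrite (_ : 8 * k = 4 * (k + k)); last by ring.
by rewrite zeta8_mul4 -mulr2n -mulr_natr abszM exprM sqrr_sign.
Qed.

Lemma zeta8_eq j k m : j = k + 8 * m -> zeta8 j = zeta8 k.
Proof. by move=> ->; rewrite zeta8D zeta8_mul8 mulr1. Qed.

Lemma zeta8_4 : zeta8 4 = -1.
Proof. by rewrite -[4]mulr1 zeta8_mul4 expr1. Qed.

Lemma phase_opp Z a x : phase Z a 0 (- x) = phase Z a 0 x - ipi R * (dotz a x)%:~R.
Proof. by rewrite /phase qformNl qformNr !pairing0 dotzNr !intrN; field. Qed.

Lemma cexp_ipi_zeta8 k : cexp (ipi R * k%:~R) = zeta8 (4 * k).
Proof. by rewrite /zeta8 intrM; congr cexp; field. Qed.

(** The substitution x -> - x. *)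
Lemma theta_term_opp Z a b n :
  theta_term Z a b 0 (- n - b) = zeta8 (4 * dotz a b) * theta_term Z a b 0 n.
Proof.
rewrite /theta_term (_ : (- n - b) *+ 2 + b = - (n *+ 2 + b)); last by lattice_eq.
rewrite phase_opp -mulrN -intrN cexpD cexp_ipi_zeta8 mulrC; congr (_ * _).
by apply: (@zeta8_eq _ _ (- dotz a n - dotz a b)); rewrite mulr2n !dotzDr; ring.
Qed.

Lemma oppB_bij b : cancel (fun n => - n - b) (fun n => - n - b).
Proof. by move=> n; lattice_eq. Qed.

Lemma theta_int_odd Z a b k : siegel_upper_half_space3 Z -> dotz a b = k * 2 + 1 ->
  theta_int Z a b 0 = 0.
Proof.
move=> hZ abk; have h := theta_int_has_sum a b 0 hZ.
have h' := has_sumZ (-1) (has_sum_bij (oppB_bij b) (oppB_bij b) h).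
have : theta_int Z a b 0 = -1 * theta_int Z a b 0.
  apply: has_sum_unique h _; move: h'; congr (has_sum _ _); apply/funext => n /=.
  rewrite theta_term_opp (@zeta8_eq _ 4 k); last by rewrite abk; ring.
  by rewrite zeta8_4 mulrA mulrNN !mul1r.
by move=> /eqP; rewrite mulN1r -addr_eq0 -mulr2n mulrn_eq0 => /eqP.
Qed.

Lemma theta_grad_even Z a b k j : siegel_upper_half_space3 Z -> dotz a b = k * 2 ->
  theta_grad Z a b j = 0.
Proof.
move=> hZ abk; have h := theta_grad_has_sum a b j hZ.
have h' := has_sumZ (-1) (has_sum_bij (oppB_bij b) (oppB_bij b) h).
have : theta_grad Z a b j = -1 * theta_grad Z a b j.
  apply: has_sum_unique h _; move: h'; congr (has_sum _ _); apply/funext => n /=.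
  rewrite theta_term_opp (@zeta8_eq _ 0 k); last by rewrite abk; ring.
  rewrite zeta8_0 (_ : (- n - b) *+ 2 + b = - (n *+ 2 + b)); last by lattice_eq.
  by rewrite [(- _ : lattice) j 0]mxE intrN; ring.
by move=> /eqP; rewrite mulN1r -addr_eq0 -mulr2n mulrn_eq0 => /eqP.
Qed.

Lemma theta_int_shift_r Z a b e z : siegel_upper_half_space3 Z ->
  theta_int Z a (b + e *+ 2) z = theta_int Z a b z.
Proof.
move=> hZ; have h := theta_int_has_sum a b z hZ.
have h' := @has_sum_bij _ _ _ _ _ (fun n => n + e) (fun n => n - e) (addrK e) (subrK e) h.
apply: has_sum_unique (theta_int_has_sum a (b + e *+ 2) z hZ) _.
move: h'; congr (has_sum _ _); apply/funext => n /=; rewrite /theta_term; congr (cexp (phase _ _ _ _)).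
by lattice_eq.
Qed.

Lemma theta_int_shift_l Z a b e z : siegel_upper_half_space3 Z ->
  theta_int Z (a + e *+ 2) b z = zeta8 (4 * dotz e b) * theta_int Z a b z.
Proof.
move=> hZ; have h := has_sumZ (zeta8 (4 * dotz e b)) (theta_int_has_sum a b z hZ).
apply: has_sum_unique (theta_int_has_sum (a + e *+ 2) b z hZ) _.
move: h; congr (has_sum _ _); apply/funext => n /=; rewrite /theta_term.
rewrite -(@zeta8_eq (4 * dotz e (n *+ 2 + b)) _ (dotz e n)); last first.
  by rewrite mulr2n !dotzDr; ring.
rewrite -cexp_ipi_zeta8 -cexpD; congr cexp; rewrite /phase mulr2n !dotzDl !intrD; by field.
Qed.

Lemma qform_int S x y : qform (map_mx intr S : 'M[C]_3) x y = (dotz x (S *m y))%:~R.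
Proof.
by rewrite /qform /dotz map_trmx -!map_mxM mulmxA mxE.
Qed.

Lemma dotz_mulmx_sym S x y : S^T = S -> dotz x (S *m y) = dotz y (S *m x).
Proof. by move=> ST; rewrite /dotz trmx00 !trmx_mul trmxK ST mulmxA. Qed.

Lemma siegel_translate Z S : S^T = S -> siegel_upper_half_space3 Z ->
  siegel_upper_half_space3 (Z - map_mx intr S).
Proof.
move=> ST [ZT Zpos]; split.
  by rewrite linearB/= ZT map_trmx ST.
move=> x x0; rewrite (_ : map_mx _ _ = map_mx (@complex.Im R) Z) ?Zpos//.
apply/matrixP => i j; rewrite !mxE -(rmorph_int (real_complex R)).
by case: (Z i j) => u v /=; rewrite oppr0 addr0.
Qed.

(** The square of an integer is congruent to it modulo 2. *)
Lemma even_quadratic S n : S^T = S ->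
  exists k : int, dotz n (S *m n) = dotz (\col_i S i i) n + k * 2.
Proof.
move=> ST.
have par (m : int) : exists k, m * m = m + k * 2.
  exists ((m * (m - 1)) %/ 2)%Z; have := divz_eq m 2; nia.
have sS i j : S i j = S j i by rewrite -{1}ST mxE.
have [k0 E0] := par (n 0 0); have [k1 E1] := par (n 1 0); have [k2 E2] := par (n 2%:R 0).
exists (S 0 0 * k0 + S 1 1 * k1 + S 2%:R 2%:R * k2 + S 0 1 * n 0 0 * n 1 0
   + S 0 2%:R * n 0 0 * n 2%:R 0 + S 1 2%:R * n 1 0 * n 2%:R 0).
rewrite !dotzE !sum3 !mxE !sum3 (sS 1 0) (sS 2%:R 0) (sS 2%:R 1).
transitivity (S 0 0 * (n 0 0 * n 0 0) + S 1 1 * (n 1 0 * n 1 0) +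
  S 2%:R 2%:R * (n 2%:R 0 * n 2%:R 0) + (S 0 1 * n 0 0 * n 1 0
   + S 0 2%:R * n 0 0 * n 2%:R 0 + S 1 2%:R * n 1 0 * n 2%:R 0) * 2); first by ring.
by rewrite E0 E1 E2; ring.
Qed.

Lemma qformBl Z Z' x y : qform (Z - Z') x y = qform Z x y - qform Z' x y.
Proof.
by rewrite /qform mulmxBr mulmxBl; set A := _ *m _; set B := _ *m _; rewrite [LHS]mxE [X in _ + X]mxE.
Qed.

(** With x = 2 n + b, the value of x^T S x / 4 is
    n^T S n + b^T S n + b^T S b / 4, and n^T S n may be replaced by the linear
    form d . n since only its parity matters.  The linear terms are absorbed in
    the characteristic. *)
Lemma theta_int_translate Z S a b z : siegel_upper_half_space3 Z -> S^T = S ->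
  let d := \col_i S i i in
  theta_int (Z - map_mx intr S) a b z =
  zeta8 (- (3 * dotz b (S *m b) + 2 * dotz d b)) * theta_int Z (a + S *m b + d) b z.
Proof.
move=> hZ ST d; have hZ' := siegel_translate ST hZ.
have h := has_sumZ (zeta8 (- (3 * dotz b (S *m b) + 2 * dotz d b)))
  (theta_int_has_sum (a + S *m b + d) b z hZ).
apply: has_sum_unique (theta_int_has_sum a b z hZ') _.
move: h; congr (has_sum _ _); apply/funext => n; rewrite /theta_term.
have [k kE] := even_quadratic n ST.
rewrite -/d in kE.
rewrite -(@zeta8_eq (- (3 * dotz b (S *m b) + 2 * dotz d b)
   - 8 * (dotz d n + k + dotz b (S *m n))) _ (- (dotz d n + k + dotz b (S *m n)))); last by ring.
rewrite /zeta8 -cexpD; congr cexp.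
rewrite /phase qformBl qform_int.
have sb : dotz (S *m b) n = dotz b (S *m n) by rewrite dotzC; exact: dotz_mulmx_sym.
have sbb : dotz (S *m b) b = dotz b (S *m b) by rewrite dotzC.
have -> : dotz (n *+ 2 + b) (S *m (n *+ 2 + b)) =
    4 * dotz d n + 8 * k + 4 * dotz b (S *m n) + dotz b (S *m b).
  rewrite mulr2n !mulmxDr !dotzDl !dotzDr (dotz_mulmx_sym n b)// kE; ring.
rewrite mulr2n !dotzDl !dotzDr sb sbb !(intrD, intrN, intrM); by field.
Qed.

End Transformations.

(** * Riemann's theta relation *)

(* Without this, comparing two terms headed by these constants unfolds matrix
   products and real functions. *)
Opaque qform pairing dotz zeta8 cexp.

Section Riemann.
Variable R : realType.
Local Notation C := R[i].
Local Open Scope complex_scope.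
Local Notation lattice := 'cV[int]_3.
Implicit Types (Z : 'M[C]_3) (z : 'cV[C]_3).

Definition col3z (x y z : int) : lattice := \col_(i < 3) [:: x; y; z]`_i.

Definition bits := (bool * bool * bool)%type.
Definition bitvec (e : bits) : lattice := col3z e.1.1 e.1.2 e.2.

Definition parities (n : lattice) : bits :=
  let p i := odd (absz (n i 0)) in (p 0, p 1, p 2%:R).

(** Division with remainder in [0, 1] of every coordinate by 2. *)
Definition halve (n : lattice) : lattice := map_mx (fun k : int => (k %/ 2)%Z) (n - bitvec (parities n)).

Lemma bitvec_halve n : halve n *+ 2 + bitvec (parities n) = n.
Proof.
apply/matrixP => i j; rewrite ord1 mulr2n /halve !mxE.
case: i => -[|[|[|//]]] i3 /=; [rewrite (_ : Ordinal i3 = 0)|rewrite (_ : Ordinal i3 = 1)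
  |rewrite (_ : Ordinal i3 = 2%:R)]; try exact: val_inj; lia.
Qed.

Lemma parities_bitvec n e : parities (n *+ 2 + bitvec e) = e.
Proof.
case: e => [[x y] z]; rewrite /parities mulr2n !mxE /=.
congr (_, _, _); lia.
Qed.

Lemma halve_bitvec n e : halve (n *+ 2 + bitvec e) = n.
Proof.
rewrite /halve parities_bitvec addrK; apply/matrixP => i j; rewrite mulr2n !mxE.
by rewrite -[X in (X %/ _)%Z]mulr2n -mulr_natr mulzK.
Qed.

(** Substituting s - x_i for x_i, where 2 s is the sum of the x_i, preserves the
    sum of the values of a quadratic form and the sum of the x_i; only the terms
    a_i . x_i change. *)
Lemma sum_phase_reflect Z z (a1 a2 a3 a4 A x1 x2 x3 x4 s : lattice) : Z^T = Z ->
  a1 + a2 + a3 + a4 = A *+ 2 -> x1 + x2 + x3 + x4 = s *+ 2 ->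
  phase Z a1 z (s - x1) + phase Z a2 z (s - x2) + phase Z a3 z (s - x3)
    + phase Z a4 z (s - x4) =
  phase Z a1 z x1 + phase Z a2 z x2 + phase Z a3 z x3 + phase Z a4 z x4 +
  ipi R * (dotz A s - (dotz a1 x1 + dotz a2 x2 + dotz a3 x3 + dotz a4 x4))%:~R.
Proof.
move=> ZT aA xs.
have qE x : qform Z (s - x) (s - x) = qform Z s s - 2 * qform Z x s + qform Z x x.
  rewrite !qformDl !qformDr !qformNl !qformNr (qformC s x)//.
  by move: (qform Z s s) (qform Z x s) (qform Z x x) => u v w; ring.
have qs : qform Z x1 s + qform Z x2 s + qform Z x3 s + qform Z x4 s =
    qform Z s s + qform Z s s.
  transitivity (qform Z (x1 + x2 + x3 + x4) s); first by rewrite !qformDl.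
  by rewrite xs mulr2n qformDl.
have ps : pairing x1 z + pairing x2 z + pairing x3 z + pairing x4 z =
    pairing s z + pairing s z.
  transitivity (pairing (x1 + x2 + x3 + x4) z); first by rewrite !pairingD.
  by rewrite xs mulr2n pairingD.
have As : (dotz a1 s)%:~R + (dotz a2 s)%:~R + (dotz a3 s)%:~R + (dotz a4 s)%:~R
   = (dotz A s)%:~R + (dotz A s)%:~R :> C.
  transitivity ((dotz (a1 + a2 + a3 + a4) s)%:~R : C); first by rewrite !dotzDl !intrD.
  by rewrite aA mulr2n dotzDl intrD.
rewrite /phase !qE !pairingD !pairingN !dotzDr !dotzNr !(intrD, intrN).
(* The remaining identity is polynomial in the values of the forms. *)
move: qs ps As.
move: (qform Z s s) (qform Z x1 s) (qform Z x2 s) (qform Z x3 s) (qform Z x4 s).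
move: (qform Z x1 x1) (qform Z x2 x2) (qform Z x3 x3) (qform Z x4 x4).
move: (pairing s z) (pairing x1 z) (pairing x2 z) (pairing x3 z) (pairing x4 z).
move: (dotz A s)%:~R (dotz a1 s)%:~R (dotz a2 s)%:~R (dotz a3 s)%:~R (dotz a4 s)%:~R.
move: (dotz a1 x1)%:~R (dotz a2 x2)%:~R (dotz a3 x3)%:~R (dotz a4 x4)%:~R (ipi R).
move=> d1 d2 d3 d4 c e e1 e2 e3 e4 p p1 p2 p3 p4 r1 r2 r3 r4 q q1 q2 q3 q4 qs ps es.
have -> : q4 = q + q - (q1 + q2 + q3) by rewrite -qs; ring.
have -> : p4 = p + p - (p1 + p2 + p3) by rewrite -ps; ring.
have -> : e4 = e + e - (e1 + e2 + e3) by rewrite -es; ring.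
by field.
Qed.

(** The sum over [e] and over the four lattice vectors of the series is a sum
    over all quadruples x_i = N + b_i + 2 m_i with m_1 = 0, where N carries the
    bits [e].  The reflection x_i -> s - x_i permutes these quadruples and
    changes the sign of the term at each of them, because the sum of the
    a_i . b_i is odd. *)
Lemma riemann_relation Z z (a1 a2 a3 a4 b1 b2 b3 b4 A B : lattice) (k : int) :
  siegel_upper_half_space3 Z ->
  a1 + a2 + a3 + a4 = A *+ 2 -> b1 + b2 + b3 + b4 = B *+ 2 ->
  dotz a1 b1 + dotz a2 b2 + dotz a3 b3 + dotz a4 b4 = k * 2 + 1 ->
  \sum_(e : bits) zeta8 R (4 * dotz A (bitvec e)) *
    (theta_int Z a1 (b1 + bitvec e) z * theta_int Z a2 (b2 + bitvec e) z *
     theta_int Z a3 (b3 + bitvec e) z * theta_int Z a4 (b4 + bitvec e) z) = 0.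
Proof.
move=> hZ aA bB ab.
pose L := (lattice * lattice * lattice * lattice)%type.
pose f (e : bits) (p : L) : C := zeta8 R (4 * dotz A (bitvec e)) *
  (theta_term Z a1 (b1 + bitvec e) z p.1.1.1 * theta_term Z a2 (b2 + bitvec e) z p.1.1.2 *
   theta_term Z a3 (b3 + bitvec e) z p.1.2 * theta_term Z a4 (b4 + bitvec e) z p.2).
have tS a b : abs_summable (theta_term Z a b z) by exact: abs_summable_theta_term.
have ts a b := theta_int_has_sum a b z hZ.
have fS e : abs_summable (f e).
  exact: (abs_summableZ _ (abs_summableM (abs_summableM (abs_summableM (tS a1 (b1 + bitvec e))
    (tS a2 (b2 + bitvec e))) (tS a3 (b3 + bitvec e))) (tS a4 (b4 + bitvec e)))).
have fs e := has_sumZ (zeta8 R (4 * dotz A (bitvec e)))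
  (has_sumM (abs_summableM (abs_summableM (tS a1 (b1 + bitvec e)) (tS a2 (b2 + bitvec e)))
     (tS a3 (b3 + bitvec e))) (tS a4 (b4 + bitvec e))
   (has_sumM (abs_summableM (tS a1 (b1 + bitvec e)) (tS a2 (b2 + bitvec e)))
     (tS a3 (b3 + bitvec e))
    (has_sumM (tS a1 (b1 + bitvec e)) (tS a2 (b2 + bitvec e)) (ts _ _) (ts _ _)) (ts _ _))
   (ts _ _)).
have hF := has_sum_finite fS fs.
set s0 := \sum_(e : bits) _ in hF *.
(* A quadruple of indices for the bits [e] is the same as [N], whose bits are
   [e], and the differences of the indices from that of [N]. *)
pose Psi (p : L) : bits * L := (parities p.1.1.1,
  (halve p.1.1.1, p.1.1.2 + halve p.1.1.1, p.1.2 + halve p.1.1.1, p.2 + halve p.1.1.1)).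
pose Phi (q : bits * L) : L := (q.2.1.1.1 *+ 2 + bitvec q.1,
  q.2.1.1.2 - q.2.1.1.1, q.2.1.2 - q.2.1.1.1, q.2.2 - q.2.1.1.1).
have PsiK : cancel Psi Phi.
  by move=> [[[n m2] m3] m4]; rewrite /Phi/Psi/= bitvec_halve !addrK.
have PhiK : cancel Phi Psi.
  move=> [e [[[n n2] n3] n4]]; rewrite /Phi/Psi/= parities_bitvec halve_bitvec.
  by rewrite !subrK.
have hG := has_sum_bij PsiK PhiK hF.
pose X1 (p : L) : lattice := p.1.1.1 + b1.
pose X2 (p : L) : lattice := p.1.1.1 + b2 + p.1.1.2 *+ 2.
pose X3 (p : L) : lattice := p.1.1.1 + b3 + p.1.2 *+ 2.
pose X4 (p : L) : lattice := p.1.1.1 + b4 + p.2 *+ 2.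
pose G (p : L) : C := zeta8 R (4 * dotz A p.1.1.1) *
  cexp (phase Z a1 z (X1 p) + phase Z a2 z (X2 p) + phase Z a3 z (X3 p) + phase Z a4 z (X4 p)).
have GE : (fun p : bits * L => f p.1 p.2) \o Psi = G.
  apply/funext => -[[[n m2] m3] m4]; rewrite /f /G /X1 /X2 /X3 /X4 /theta_term /=.
  have nE := bitvec_halve n; move: (halve n) (parities n) nE => h e <-.
  rewrite [in RHS](@zeta8_eq R _ (4 * dotz A (bitvec e)) (dotz A h)); last first.
    by rewrite mulr2n !dotzDr; ring.
  have -> : h *+ 2 + bitvec e + b1 = h *+ 2 + (b1 + bitvec e) by lattice_eq.
  have E m b : h *+ 2 + bitvec e + b + m *+ 2 = (m + h) *+ 2 + (b + bitvec e) by lattice_eq.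
  by rewrite !E !cexpD.
rewrite {}GE in hG.
pose s (p : L) : lattice := p.1.1.1 *+ 2 + B + p.1.1.2 + p.1.2 + p.2.
(* In the coordinates [N], [m2], [m3], [m4] the reflection is affine. *)
pose tau (p : L) : L := (s p - p.1.1.1 - b1 *+ 2, b1 - b2 - p.1.1.2, b1 - b3 - p.1.2, b1 - b4 - p.2).
have b4E : b4 = B *+ 2 - b1 - b2 - b3 by rewrite -bB; lattice_eq.
have s_tau p : s (tau p) = s p by rewrite /s /tau/= b4E; lattice_eq.
have tauK : cancel tau tau.
  move=> [[[n m2] m3] m4]; rewrite {1}/tau s_tau /tau/=.
  by congr (_, _, _, _); lattice_eq.
have h2 := has_sum_bij tauK tauK hG.
have XE p : [/\ X1 (tau p) = s p - X1 p, X2 (tau p) = s p - X2 p,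
    X3 (tau p) = s p - X3 p & X4 (tau p) = s p - X4 p].
  by split; rewrite /X1 /X2 /X3 /X4 /tau/=; lattice_eq.
have Xs p : X1 p + X2 p + X3 p + X4 p = s p *+ 2.
  by rewrite /s /X1 /X2 /X3 /X4 b4E; lattice_eq.
suff : s0 = (-1) * s0.
  by move=> /eqP; rewrite mulN1r -addr_eq0 -mulr2n mulrn_eq0 => /eqP.
apply: (has_sum_unique hG).
have := has_sumZ (-1) h2; congr (has_sum _ _); apply/funext => p.
rewrite /= /G; have [-> -> -> ->] := XE p.
have [ZT _] := hZ.
rewrite (sum_phase_reflect z ZT aA (Xs p)) cexpD cexp_ipi_zeta8.
set D := dotz A (s p) - _.
have -> : zeta8 R (4 * dotz A p.1.1.1) =
    (-1) * (zeta8 R (4 * dotz A (tau p).1.1.1) * zeta8 R (4 * D)).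
  rewrite -zeta8_4 -!zeta8D /D.
  have a1n n : dotz a1 n = 2 * dotz A n - dotz a2 n - dotz a3 n - dotz a4 n.
    have <- : dotz a1 n + dotz a2 n + dotz a3 n + dotz a4 n = 2 * dotz A n.
      by rewrite -!dotzDl aA mulr2n dotzDl; ring.
    by ring.
  have abz : dotz a1 b1 = k * 2 + 1 - dotz a2 b2 - dotz a3 b3 - dotz a4 b4.
    by rewrite -ab; ring.
  apply: (@zeta8_eq R _ _ (- (dotz A (s p) - 2 * dotz A p.1.1.1 - dotz A b1 - k
    - (dotz a2 p.1.1.2 + dotz a3 p.1.2 + dotz a4 p.2)))).
  rewrite /X1 /X2 /X3 /X4 /tau/= !mulr2n !(dotzDr, dotzNr) abz a1n; ring.
by move: (cexp _) (zeta8 _ _) (zeta8 _ _) => u v w; ring.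
Qed.

End Riemann.

(** * Characteristics as bit vectors *)

Section Characters.
Variable R : realType.
Local Notation C := R[i].
Local Open Scope complex_scope.
Implicit Types (Z : 'M[C]_3) (z : 'cV[C]_3).

Definition int3 := (int * int * int)%type.
Definition vec3 (t : int3) : 'cV[int]_3 := col3z t.1.1 t.1.2 t.2.
Definition add3 (t u : int3) : int3 := (t.1.1 + u.1.1, t.1.2 + u.1.2, t.2 + u.2).
Definition dot3 (t u : int3) : int := t.1.1 * u.1.1 + t.1.2 * u.1.2 + t.2 * u.2.
Definition of_bits (e : bits) : int3 := (e.1.1 : int, e.1.2 : int, e.2 : int).
(** With [half3], the decomposition of a vector into bits and an even part. *)
Definition odd3 (t : int3) : bits := (odd `|t.1.1|%N, odd `|t.1.2|%N, odd `|t.2|%N).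
Definition half3 (t : int3) : int3 :=
  let h k := ((k - (odd `|k|%N : nat)%:Z) %/ 2)%Z in (h t.1.1, h t.1.2, h t.2).

Lemma ord3P (P : 'I_3 -> Prop) : P 0 -> P 1 -> P 2%:R -> forall i, P i.
Proof.
move=> P0 P1 P2 -[[|[|[|//]]] i3].
- by rewrite (_ : Ordinal i3 = 0)//; exact: val_inj.
- by rewrite (_ : Ordinal i3 = 1)//; exact: val_inj.
- by rewrite (_ : Ordinal i3 = 2%:R)//; exact: val_inj.
Qed.

Lemma vec3_add t u : vec3 (add3 t u) = vec3 t + vec3 u.
Proof. by apply/matrixP => i j; rewrite !mxE; elim/ord3P: i. Qed.

Lemma dotz_vec3 t u : dotz (vec3 t) (vec3 u) = dot3 t u.
Proof. by rewrite dotzE sum3 !mxE. Qed.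

Lemma bitvec_vec3 e : bitvec e = vec3 (of_bits e).
Proof. by []. Qed.

(** Reduction of a characteristic modulo its periods. *)
Lemma half3E t : vec3 t = bitvec (odd3 t) + vec3 (half3 t) *+ 2.
Proof.
case: t => [[x y] z]; apply/matrixP => i j; rewrite mulr2n !mxE.
by elim/ord3P: i => /=; lia.
Qed.

Definition sym3 (s1 s2 s3 s12 s13 s23 : int) : 'M[int]_3 :=
  \matrix_(i < 3, j < 3)
    (nth [::] [:: [:: s1; s12; s13]; [:: s12; s2; s23]; [:: s13; s23; s3]] i)`_j.

(** A symmetric matrix, as its diagonal and its entries (1,2), (1,3), (2,3). *)
Definition symdata := (int3 * int3)%type.
Definition symmx (s : symdata) : 'M[int]_3 :=
  sym3 s.1.1.1 s.1.1.2 s.1.2 s.2.1.1 s.2.1.2 s.2.2.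
Definition smul (s : symdata) (b : int3) : int3 :=
  (s.1.1.1 * b.1.1 + s.2.1.1 * b.1.2 + s.2.1.2 * b.2,
   s.2.1.1 * b.1.1 + s.1.1.2 * b.1.2 + s.2.2 * b.2,
   s.2.1.2 * b.1.1 + s.2.2 * b.1.2 + s.1.2 * b.2).

Lemma symmx_tr s : (symmx s)^T = symmx s.
Proof.
by apply/matrixP => i j; rewrite !mxE; elim/ord3P: i; elim/ord3P: j.
Qed.

Lemma symmx_mul s b : symmx s *m vec3 b = vec3 (smul s b).
Proof. by apply/matrixP => i j; rewrite mxE sum3 !mxE; elim/ord3P: i. Qed.

Lemma symmx_diag s : \col_i symmx s i i = vec3 s.1.
Proof. by apply/matrixP => i j; rewrite !mxE; elim/ord3P: i. Qed.

Definition char := (bits * bits)%type.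
Definition theta_char Z (c : char) z := theta_int Z (bitvec c.1) (bitvec c.2) z.
Definition grad_char Z (c : char) j := theta_grad Z (bitvec c.1) (bitvec c.2) j.

(** The characteristic at Z of the theta function which at Z - S has the
    characteristic [c] with [e] added to its second row. *)
Definition shift_char (s : symdata) (c : char) (e : bits) : char :=
  let b := add3 (of_bits c.2) (of_bits e) in
  (odd3 (add3 (add3 (of_bits c.1) (smul s b)) s.1), odd3 b).

(** The exponent of the eighth root of unity that comes with [shift_char]. *)
Definition shift_exp (s : symdata) (c : char) (e : bits) : int :=
  let b := add3 (of_bits c.2) (of_bits e) in
  4 * dot3 (half3 (add3 (add3 (of_bits c.1) (smul s b)) s.1)) (of_bits (odd3 b))
  - (3 * dot3 b (smul s b) + 2 * dot3 s.1 b).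

(** Translation by S, followed by the reduction of both rows modulo 2. *)
Lemma theta_shift Z s c e z : siegel_upper_half_space3 Z ->
  theta_int (Z - map_mx intr (symmx s)) (bitvec c.1) (bitvec c.2 + bitvec e) z =
  zeta8 R (shift_exp s c e) * theta_char Z (shift_char s c e) z.
Proof.
move=> hZ; rewrite theta_int_translate ?symmx_tr// symmx_diag.
rewrite !bitvec_vec3 -vec3_add symmx_mul -!vec3_add !dotz_vec3.
rewrite [X in theta_int _ X _ _]half3E [X in theta_int _ _ X _]half3E.
rewrite theta_int_shift_r// theta_int_shift_l// mulrA -zeta8D [X in zeta8 _ X]addrC.
by rewrite bitvec_vec3 dotz_vec3.
Qed.

Definition all_bits : seq bits :=
  [:: (false, false, false); (false, false, true); (false, true, false); (false, true, true);
      (true, false, false); (true, false, true); (true, true, false); (true, true, true)].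

Lemma sum_bits (F : bits -> C) : \sum_e F e = \sum_(e <- all_bits) F e.
Proof.
apply/esym/perm_big/uniq_perm => //; first exact: index_enum_uniq.
by move=> [[[] []] []]; rewrite mem_index_enum.
Qed.

Definition rel_exp s (A : int3) c1 c2 c3 c4 e : int :=
  ((4 * dot3 A (of_bits e) + (shift_exp s c1 e + shift_exp s c2 e + shift_exp s c3 e
    + shift_exp s c4 e)) %% 8)%Z.

Lemma zeta8_mod k : zeta8 R (k %% 8)%Z = zeta8 R k.
Proof. by apply/esym/(@zeta8_eq R _ _ (k %/ 8)%Z); rewrite [LHS](divz_eq k 8); ring. Qed.

Lemma siegel_untranslate Z s : siegel_upper_half_space3 Z ->
  siegel_upper_half_space3 (Z - map_mx intr (symmx s)).
Proof. by move=> hZ; apply: siegel_translate => //; exact: symmx_tr. Qed.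

(** Riemann's relation at Z - S, rewritten in terms of theta functions at Z.
    Varying S moves the relation to other sets of characteristics. *)
Lemma riemann_char Z s z (c1 c2 c3 c4 : char) (A B : int3) (k : int) :
  siegel_upper_half_space3 Z ->
  bitvec c1.1 + bitvec c2.1 + bitvec c3.1 + bitvec c4.1 = vec3 A *+ 2 ->
  bitvec c1.2 + bitvec c2.2 + bitvec c3.2 + bitvec c4.2 = vec3 B *+ 2 ->
  dot3 (of_bits c1.1) (of_bits c1.2) + dot3 (of_bits c2.1) (of_bits c2.2)
  + dot3 (of_bits c3.1) (of_bits c3.2) + dot3 (of_bits c4.1) (of_bits c4.2) = k * 2 + 1 ->
  \sum_(e <- all_bits) zeta8 R (rel_exp s A c1 c2 c3 c4 e) *
    (theta_char Z (shift_char s c1 e) z * theta_char Z (shift_char s c2 e) z *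
     theta_char Z (shift_char s c3 e) z * theta_char Z (shift_char s c4 e) z) = 0.
Proof.
move=> hZ cA cB ck.
have := riemann_relation z (siegel_untranslate s hZ) cA cB.
rewrite !bitvec_vec3 !dotz_vec3 => /(_ k ck).
rewrite sum_bits => rel; rewrite -[RHS]rel; apply: eq_bigr => e _.
rewrite -!bitvec_vec3 !theta_shift// bitvec_vec3 dotz_vec3.
rewrite zeta8_mod !zeta8D.
move: (zeta8 _ _) (zeta8 _ _) (zeta8 _ _) (zeta8 _ _) (zeta8 _ _) => u u1 u2 u3 u4.
move: (theta_char _ _ _) (theta_char _ _ _) (theta_char _ _ _) (theta_char _ _ _) => v1 v2 v3 v4.
ring.
Qed.

(** The derivative of a product of four theta functions at 0. *)
Definition quad_grad Z (c1 c2 c3 c4 : char) j : C :=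
  let t c := theta_char Z c 0 in let g c := grad_char Z c j in
  g c1 * t c2 * t c3 * t c4 + t c1 * g c2 * t c3 * t c4
  + t c1 * t c2 * g c3 * t c4 + t c1 * t c2 * t c3 * g c4.

Lemma theta_char_expansion Z c j : siegel_upper_half_space3 Z ->
  expansion1 (fun h => theta_char Z c (h *: delta_mx j 0)) (grad_char Z c j).
Proof. exact: theta_expansion. Qed.

Lemma quad_expansion Z c1 c2 c3 c4 j : siegel_upper_half_space3 Z ->
  expansion1 (fun h => theta_char Z c1 (h *: delta_mx j 0) * theta_char Z c2 (h *: delta_mx j 0)
    * theta_char Z c3 (h *: delta_mx j 0) * theta_char Z c4 (h *: delta_mx j 0))
    (quad_grad Z c1 c2 c3 c4 j).
Proof.
move=> hZ; have D c := theta_char_expansion c j hZ.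
have := expansion1M (expansion1M (expansion1M (D c1) (D c2)) (D c3)) (D c4).
rewrite /quad_grad !scale0r; congr expansion1.
move: (theta_char _ c1 0) (theta_char _ c2 0) (theta_char _ c3 0) (theta_char _ c4 0).
move: (grad_char _ c1 j) (grad_char _ c2 j) (grad_char _ c3 j) (grad_char _ c4 j).
move=> *; ring.
Qed.

(** A relation that holds for all z may be differentiated at 0. *)
Lemma relation_gradient Z (I : Type) (r : seq I) (w : I -> C) (c1 c2 c3 c4 : I -> char) j :
  siegel_upper_half_space3 Z ->
  (forall z, \sum_(i <- r) w i * (theta_char Z (c1 i) z * theta_char Z (c2 i) z *
     theta_char Z (c3 i) z * theta_char Z (c4 i) z) = 0) ->
  \sum_(i <- r) w i * quad_grad Z (c1 i) (c2 i) (c3 i) (c4 i) j = 0.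
Proof.
move=> hZ rel.
pose f i (h : C) := let z := h *: delta_mx j 0 in
  w i * (theta_char Z (c1 i) z * theta_char Z (c2 i) z * theta_char Z (c3 i) z *
  theta_char Z (c4 i) z).
have fE i : expansion1 (f i) (w i * quad_grad Z (c1 i) (c2 i) (c3 i) (c4 i) j).
  have := expansion1M (expansion1_cst (w i))
    (quad_expansion (c1 i) (c2 i) (c3 i) (c4 i) j hZ).
  by rewrite mul0r add0r.
have : expansion1 (fun h => \sum_(i <- r) f i h)
    (\sum_(i <- r) w i * quad_grad Z (c1 i) (c2 i) (c3 i) (c4 i) j).
  elim: r {rel} => [|i r IH].
    rewrite big_nil (_ : (fun _ => _) = fun=> 0); first exact: expansion1_cst.
    by apply/funext => h; rewrite big_nil.
  rewrite big_cons (_ : (fun _ => _) = fun h => f i h + \sum_(i <- r) f i h).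
    exact: expansion1D.
  by apply/funext => h; rewrite big_cons.
have -> : (fun h => \sum_(i <- r) f i h) = fun=> 0 by apply/funext => h; exact: rel.
by move=> /expansion1_uniq; apply; exact: expansion1_cst.
Qed.

Definition odd_char (c : char) : bool :=
  (c.1.1.1 && c.2.1.1) (+) (c.1.1.2 && c.2.1.2) (+) (c.1.2 && c.2.2).

Lemma dot3_parity (c : char) : let m := dot3 (of_bits c.1) (of_bits c.2) in
  m = (m %/ 2)%Z * 2 + (odd_char c : nat)%:Z.
Proof. by move: c => [[[[] []] []] [[[] []] []]]. Qed.

Lemma theta_charE Z c : siegel_upper_half_space3 Z ->
  theta_char Z c 0 = if odd_char c then 0 else theta_char Z c 0.
Proof.
move=> hZ; case: ifP => // co.
apply: (@theta_int_odd R Z _ _ (dot3 (of_bits c.1) (of_bits c.2) %/ 2)%Z hZ).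
by rewrite !bitvec_vec3 dotz_vec3 {1}dot3_parity co.
Qed.

Lemma grad_charE Z c j : siegel_upper_half_space3 Z ->
  grad_char Z c j = if odd_char c then grad_char Z c j else 0.
Proof.
move=> hZ; case: ifP => // co.
apply: (@theta_grad_even R Z _ _ (dot3 (of_bits c.1) (of_bits c.2) %/ 2)%Z j hZ).
by rewrite !bitvec_vec3 dotz_vec3 {1}dot3_parity co addr0.
Qed.

End Characters.

(** * Coplanar gradients *)

Section Bitangents.
Variable R : realType.
Local Notation C := R[i].
Local Open Scope complex_scope.
Implicit Types (Z : 'M[C]_3).

Local Notation t Z c := (theta_char Z c 0).
Local Notation g := grad_char.

(** Odd theta functions vanish at 0 and even ones have zero gradient there, so
    only products with exactly one odd factor survive. *)
Lemma quad_gradE Z c1 c2 c3 c4 j : siegel_upper_half_space3 Z ->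
  quad_grad Z c1 c2 c3 c4 j =
  match odd_char c1, odd_char c2, odd_char c3, odd_char c4 with
  | true, false, false, false => t Z c2 * t Z c3 * t Z c4 * g Z c1 j
  | false, true, false, false => t Z c1 * t Z c3 * t Z c4 * g Z c2 j
  | false, false, true, false => t Z c1 * t Z c2 * t Z c4 * g Z c3 j
  | false, false, false, true => t Z c1 * t Z c2 * t Z c3 * g Z c4 j
  | _, _, _, _ => 0
  end.
Proof.
move=> hZ; have T c := theta_charE c hZ; have G c := grad_charE c j hZ.
rewrite /quad_grad /=.
move: (T c1) (T c2) (T c3) (T c4) (G c1) (G c2) (G c3) (G c4).
move: (t Z c1) (t Z c2) (t Z c3) (t Z c4) (g Z c1 j) (g Z c2 j) (g Z c3 j) (g Z c4 j).
move=> t1 t2 t3 t4 g1 g2 g3 g4.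
by case: (odd_char c1); case: (odd_char c2); case: (odd_char c3); case: (odd_char c4);
  move=> *; subst; ring.
Qed.

(** Twice the entries of the characteristic, as digits 0 and 1, [a] first. *)
Definition ch (a1 a2 a3 b1 b2 b3 : nat) : char :=
  ((a1 == 1, a2 == 1, a3 == 1), (b1 == 1, b2 == 1, b3 == 1))%N.

(** The numerical content of one term of a relation, in a form that can be
    computed. *)
Definition rel_data s A c1 c2 c3 c4 (e : bits) : int * (char * char * char * char) :=
  (rel_exp s A c1 c2 c3 c4 e,
   (shift_char s c1 e, shift_char s c2 e, shift_char s c3 e, shift_char s c4 e)).

Lemma vec3_double (a b c d A : int3) :
  add3 (add3 (add3 a b) c) d = add3 A A -> vec3 a + vec3 b + vec3 c + vec3 d = vec3 A *+ 2.
Proof. by rewrite mulr2n -!vec3_add => ->. Qed.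

Lemma gradient_relation Z s (c1 c2 c3 c4 : char) (A B : int3) (k : int) j :
  siegel_upper_half_space3 Z ->
  add3 (add3 (add3 (of_bits c1.1) (of_bits c2.1)) (of_bits c3.1)) (of_bits c4.1) = add3 A A ->
  add3 (add3 (add3 (of_bits c1.2) (of_bits c2.2)) (of_bits c3.2)) (of_bits c4.2) = add3 B B ->
  dot3 (of_bits c1.1) (of_bits c1.2) + dot3 (of_bits c2.1) (of_bits c2.2)
  + dot3 (of_bits c3.1) (of_bits c3.2) + dot3 (of_bits c4.1) (of_bits c4.2) = k * 2 + 1 ->
  \sum_(p <- map (rel_data s A c1 c2 c3 c4) all_bits)
    zeta8 R p.1 * quad_grad Z p.2.1.1.1 p.2.1.1.2 p.2.1.2 p.2.2 j = 0.
Proof.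
move=> hZ /vec3_double cA /vec3_double cB ck; rewrite big_map.
apply: relation_gradient => // z; exact: riemann_char hZ cA cB ck.
Qed.

Lemma zeta8_6 : zeta8 R 6 = - zeta8 R 2.
Proof. by rewrite -mulN1r -zeta8_4 -zeta8D. Qed.

(** Riemann's relation for the matrix S with entries 1 at (1,2), (2,3) and their
    transposes.  Four of its eight products have three odd factors; the odd
    factors of the other four are w1, w2, w3 and w7. *)
Lemma coplanar_w1_w2_w3_w7 Z : siegel_upper_half_space3 Z ->
  exists c d : C, forall j,
    t Z (ch 0 1 0 0 0 0) * t Z (ch 0 1 1 0 1 1) * t Z (ch 1 0 0 0 1 0) * g Z (ch 1 0 1 0 0 1) j +
    t Z (ch 0 0 0 0 0 1) * t Z (ch 0 0 1 0 1 0) * t Z (ch 1 1 1 0 0 0) * g Z (ch 1 1 0 0 1 1) j +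
    c * g Z (ch 1 1 1 0 1 0) j + d * g Z (ch 0 0 1 1 1 1) j = 0.
Proof.
move=> hZ.
exists (- (t Z (ch 1 1 0 0 0 1) * t Z (ch 0 0 1 0 0 0) * t Z (ch 0 0 0 0 1 1))),
  (t Z (ch 0 0 0 1 0 0) * t Z (ch 1 1 0 1 1 0) * t Z (ch 1 1 1 1 0 1)) => j.
have := @gradient_relation Z ((0, 0, 0), (1, 0, 1))
  (ch 0 1 0 0 0 0) (ch 1 0 0 0 1 1) (ch 0 0 1 0 1 0) (ch 1 1 1 0 0 1)
  (1, 1, 1) (0, 1, 1) 0 j hZ erefl erefl erefl.
have -> : map (rel_data ((0, 0, 0), (1, 0, 1)) (1, 1, 1)
    (ch 0 1 0 0 0 0) (ch 1 0 0 0 1 1) (ch 0 0 1 0 1 0) (ch 1 1 1 0 0 1)) all_bits =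
  [:: (2 : int, (ch 0 1 0 0 0 0, ch 0 1 1 0 1 1, ch 1 0 0 0 1 0, ch 1 0 1 0 0 1));
      (2 : int, (ch 0 0 0 0 0 1, ch 0 0 1 0 1 0, ch 1 1 0 0 1 1, ch 1 1 1 0 0 0));
      (6 : int, (ch 1 1 1 0 1 0, ch 1 1 0 0 0 1, ch 0 0 1 0 0 0, ch 0 0 0 0 1 1));
      (6 : int, (ch 1 0 1 0 1 1, ch 1 0 0 0 0 0, ch 0 1 1 0 0 1, ch 0 1 0 0 1 0));
      (2 : int, (ch 0 0 0 1 0 0, ch 0 0 1 1 1 1, ch 1 1 0 1 1 0, ch 1 1 1 1 0 1));
      (2 : int, (ch 0 1 0 1 0 1, ch 0 1 1 1 1 0, ch 1 0 0 1 1 1, ch 1 0 1 1 0 0));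
      (6 : int, (ch 1 0 1 1 1 0, ch 1 0 0 1 0 1, ch 0 1 1 1 0 0, ch 0 1 0 1 1 1));
      (6 : int, (ch 1 1 1 1 1 1, ch 1 1 0 1 0 0, ch 0 0 1 1 0 1, ch 0 0 0 1 1 0))].
  by vm_compute.
rewrite !big_cons big_nil !quad_gradE// => rel0.
have rel : zeta8 R 2 * (t Z (ch 0 1 0 0 0 0) * t Z (ch 0 1 1 0 1 1) * t Z (ch 1 0 0 0 1 0)
    * g Z (ch 1 0 1 0 0 1) j) + (
  zeta8 R 2 * (t Z (ch 0 0 0 0 0 1) * t Z (ch 0 0 1 0 1 0) * t Z (ch 1 1 1 0 0 0)
    * g Z (ch 1 1 0 0 1 1) j) + (
  zeta8 R 6 * (t Z (ch 1 1 0 0 0 1) * t Z (ch 0 0 1 0 0 0) * t Z (ch 0 0 0 0 1 1)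
    * g Z (ch 1 1 1 0 1 0) j) + (
  zeta8 R 6 * (0) + (
  zeta8 R 2 * (t Z (ch 0 0 0 1 0 0) * t Z (ch 1 1 0 1 1 0) * t Z (ch 1 1 1 1 0 1)
    * g Z (ch 0 0 1 1 1 1) j) + (
  zeta8 R 2 * (0) + (
  zeta8 R 6 * (0) + (
  zeta8 R 6 * (0) + (
  0)))))))) = 0 := rel0.
apply: (mulfI (zeta8_neq0 R 2)); rewrite mulr0 -{}[RHS]rel zeta8_6 {rel0}.
move: (t Z (ch 0 1 0 0 0 0)) (t Z (ch 0 1 1 0 1 1)) (t Z (ch 1 0 0 0 1 0)) (g Z (ch 1 0 1 0 0 1) j).
move: (t Z (ch 0 0 0 0 0 1)) (t Z (ch 0 0 1 0 1 0)) (t Z (ch 1 1 1 0 0 0)) (g Z (ch 1 1 0 0 1 1) j).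
move: (t Z (ch 1 1 0 0 0 1)) (t Z (ch 0 0 1 0 0 0)) (t Z (ch 0 0 0 0 1 1)) (g Z (ch 1 1 1 0 1 0) j).
move: (t Z (ch 0 0 0 1 0 0)) (t Z (ch 1 1 0 1 1 0)) (t Z (ch 1 1 1 1 0 1)) (g Z (ch 0 0 1 1 1 1) j).
by move: (zeta8 R 2) => *; ring.
Qed.

(** Riemann's relation for the matrix S with entries 1 at (1,1), (2,3) and (3,2).
    The coefficients of w1 and w2 are those of [coplanar_w1_w2_w3_w7], with the
    same signs; that is what makes the two relations combine. *)
Lemma coplanar_w1_w2_w3'_w7' Z : siegel_upper_half_space3 Z ->
  exists c d : C, forall j,
    t Z (ch 0 1 0 0 0 0) * t Z (ch 0 1 1 0 1 1) * t Z (ch 1 0 0 0 1 0) * g Z (ch 1 0 1 0 0 1) j +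
    t Z (ch 0 0 0 0 0 1) * t Z (ch 0 0 1 0 1 0) * t Z (ch 1 1 1 0 0 0) * g Z (ch 1 1 0 0 1 1) j +
    c * g Z (ch 0 1 1 0 1 0) j + d * g Z (ch 1 1 0 1 0 1) j = 0.
Proof.
move=> hZ.
exists (- (t Z (ch 0 1 0 0 0 1) * t Z (ch 1 0 1 0 0 0) * t Z (ch 1 0 0 0 1 1))),
  (- (t Z (ch 1 1 1 1 1 0) * t Z (ch 0 0 1 1 0 0) * t Z (ch 0 0 0 1 1 1))) => j.
have := @gradient_relation Z ((1, 0, 0), (0, 0, 1))
  (ch 1 1 0 0 0 0) (ch 1 0 0 0 1 1) (ch 0 0 1 0 1 0) (ch 0 1 1 0 0 1)
  (1, 1, 1) (0, 1, 1) 0 j hZ erefl erefl erefl.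
have -> : map (rel_data ((1, 0, 0), (0, 0, 1)) (1, 1, 1)
    (ch 1 1 0 0 0 0) (ch 1 0 0 0 1 1) (ch 0 0 1 0 1 0) (ch 0 1 1 0 0 1)) all_bits =
  [:: (2 : int, (ch 0 1 0 0 0 0, ch 0 1 1 0 1 1, ch 1 0 0 0 1 0, ch 1 0 1 0 0 1));
      (2 : int, (ch 0 0 0 0 0 1, ch 0 0 1 0 1 0, ch 1 1 0 0 1 1, ch 1 1 1 0 0 0));
      (6 : int, (ch 0 1 1 0 1 0, ch 0 1 0 0 0 1, ch 1 0 1 0 0 0, ch 1 0 0 0 1 1));
      (6 : int, (ch 0 0 1 0 1 1, ch 0 0 0 0 0 0, ch 1 1 1 0 0 1, ch 1 1 0 0 1 0));
      (2 : int, (ch 1 1 0 1 0 0, ch 1 1 1 1 1 1, ch 0 0 0 1 1 0, ch 0 0 1 1 0 1));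
      (2 : int, (ch 1 0 0 1 0 1, ch 1 0 1 1 1 0, ch 0 1 0 1 1 1, ch 0 1 1 1 0 0));
      (6 : int, (ch 1 1 1 1 1 0, ch 1 1 0 1 0 1, ch 0 0 1 1 0 0, ch 0 0 0 1 1 1));
      (6 : int, (ch 1 0 1 1 1 1, ch 1 0 0 1 0 0, ch 0 1 1 1 0 1, ch 0 1 0 1 1 0))].
  by vm_compute.
rewrite !big_cons big_nil !quad_gradE// => rel0.
have rel : zeta8 R 2 * (t Z (ch 0 1 0 0 0 0) * t Z (ch 0 1 1 0 1 1) * t Z (ch 1 0 0 0 1 0)
    * g Z (ch 1 0 1 0 0 1) j) + (
  zeta8 R 2 * (t Z (ch 0 0 0 0 0 1) * t Z (ch 0 0 1 0 1 0) * t Z (ch 1 1 1 0 0 0)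
    * g Z (ch 1 1 0 0 1 1) j) + (
  zeta8 R 6 * (t Z (ch 0 1 0 0 0 1) * t Z (ch 1 0 1 0 0 0) * t Z (ch 1 0 0 0 1 1)
    * g Z (ch 0 1 1 0 1 0) j) + (
  zeta8 R 6 * (0) + (
  zeta8 R 2 * (0) + (
  zeta8 R 2 * (0) + (
  zeta8 R 6 * (t Z (ch 1 1 1 1 1 0) * t Z (ch 0 0 1 1 0 0) * t Z (ch 0 0 0 1 1 1)
    * g Z (ch 1 1 0 1 0 1) j) + (
  zeta8 R 6 * (0) + (
  0)))))))) = 0 := rel0.
apply: (mulfI (zeta8_neq0 R 2)); rewrite mulr0 -{}[RHS]rel zeta8_6 {rel0}.
move: (t Z (ch 0 1 0 0 0 0)) (t Z (ch 0 1 1 0 1 1)) (t Z (ch 1 0 0 0 1 0)) (g Z (ch 1 0 1 0 0 1) j).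
move: (t Z (ch 0 0 0 0 0 1)) (t Z (ch 0 0 1 0 1 0)) (t Z (ch 1 1 1 0 0 0)) (g Z (ch 1 1 0 0 1 1) j).
move: (t Z (ch 0 1 0 0 0 1)) (t Z (ch 1 0 1 0 0 0)) (t Z (ch 1 0 0 0 1 1)) (g Z (ch 0 1 1 0 1 0) j).
move: (t Z (ch 1 1 1 1 1 0)) (t Z (ch 0 0 1 1 0 0)) (t Z (ch 0 0 0 1 1 1)) (g Z (ch 1 1 0 1 0 1) j).
by move: (zeta8 R 2) => *; ring.
Qed.

End Bitangents.

(** * Jacobian Nullwerte *)

Section JacobianNullwerte.
Variable R : realType.
Local Notation C := R[i].
Local Open Scope complex_scope.
Local Notation lattice := 'cV[int]_3.
Implicit Types (Z : 'M[C]_3) (a b n x : lattice).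

Lemma det3 (F : comNzRingType) (M : 'M[F]_3) : \det M =
  M 0 0 * (M 1 1 * M 2%:R 2%:R - M 1 2%:R * M 2%:R 1)
  - M 0 1 * (M 1 0 * M 2%:R 2%:R - M 1 2%:R * M 2%:R 0)
  + M 0 2%:R * (M 1 0 * M 2%:R 1 - M 1 1 * M 2%:R 0).
Proof.
have det2 (N : 'M[F]_2) : \det N = N 0 0 * N 1 1 - N 0 1 * N 1 0.
  rewrite (expand_det_row _ 0) !big_ord_recl big_ord0 /cofactor !det_mx11 !mxE /= addr0.
  rewrite expr0 mul1r expr1 mulN1r mulrN.
  by congr (N _ _ * N _ _ - N _ _ * N _ _); exact: val_inj.
rewrite (expand_det_row _ 0) sum3 /cofactor !det2 !mxE /=.
have -> : lift (0 : 'I_3) (0 : 'I_2) = 1 by exact: val_inj.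
have -> : lift (0 : 'I_3) (1 : 'I_2) = 2%:R by exact: val_inj.
have -> : lift (1 : 'I_3) (0 : 'I_2) = 0 by exact: val_inj.
have -> : lift (1 : 'I_3) (1 : 'I_2) = 2%:R by exact: val_inj.
have -> : lift (2%:R : 'I_3) (0 : 'I_2) = 0 by exact: val_inj.
have -> : lift (2%:R : 'I_3) (1 : 'I_2) = 1 by exact: val_inj.
have -> : (0 + (1 %% 3 + 1 %% 3) %% 3 = 2)%N by [].
have -> : (0 + 1 %% 3 = 1)%N by [].
by rewrite expr0 expr1 sqrrN expr1n; ring.
Qed.

Definition grad_det (v1 v2 v3 : 'I_3 -> C) : C :=
  v1 0 * (v2 1 * v3 2%:R - v2 2%:R * v3 1) - v1 1 * (v2 0 * v3 2%:R - v2 2%:R * v3 0)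
  + v1 2%:R * (v2 0 * v3 1 - v2 1 * v3 0).

Definition jac Z (c1 c2 c3 : char) : C := grad_det (grad_char Z c1) (grad_char Z c2) (grad_char Z c3).

Definition characteristic_of (c : char) : characteristic R :=
  (halfchar R (bitvec c.1), halfchar R (bitvec c.2)).

Lemma det_rows (F : 'I_3 -> 'I_3 -> C) :
  \det (\matrix_(i < 3, j < 3) F i j) = grad_det (F 0) (F 1) (F 2%:R).
Proof. by rewrite det3 !mxE. Qed.

Lemma derive_theta Z c j : siegel_upper_half_space3 Z ->
  'D_(delta_mx j 0) (theta (characteristic_of c) Z) 0 = grad_char Z c j.
Proof.
move=> hZ; apply: expansion1_derive.
rewrite (_ : (fun h => _) = fun h => theta_char Z c (h *: delta_mx j 0)).
  exact: theta_char_expansion.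
by apply/funext => h; rewrite theta_halfchar.
Qed.

Lemma jacobian_nullwertE Z c1 c2 c3 : siegel_upper_half_space3 Z ->
  jacobian_nullwert (characteristic_of c1) (characteristic_of c2) (characteristic_of c3) Z =
  pi%:C ^+ 3 * jac Z c1 c2 c3.
Proof.
move=> hZ; rewrite /jacobian_nullwert det_rows; congr (_ * _); rewrite /jac.
pose t i := tnth [tuple characteristic_of c1; characteristic_of c2; characteristic_of c3] i.
have t0 : t 0 = characteristic_of c1 by [].
have t1 : t 1 = characteristic_of c2 by [].
have t2 : t 2%:R = characteristic_of c3 by [].
rewrite -!/(t _) t0 t1 t2.
by congr grad_det; apply/funext => j; exact: derive_theta.
Qed.

Lemma grad_det0 v1 v2 v3 : (forall j, v1 j = 0) -> grad_det v1 v2 v3 = 0.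
Proof. by move=> v0; rewrite /grad_det !v0 !mul0r subr0 addr0. Qed.

Lemma jac_even Z c1 c2 c3 : siegel_upper_half_space3 Z -> ~~ odd_char c1 ->
  jac Z c1 c2 c3 = 0.
Proof. by move=> hZ /negbTE c1e; apply: grad_det0 => j; rewrite grad_charE// c1e. Qed.

(** Expanding along the first row, each relation gives a proportion between two
    determinants with the same ratio - A : B. *)
Lemma concurrent_lines (v1 v2 v3 v4 v5 v6 : 'I_3 -> C) (A B c d c' d' : C) :
  (forall j, A * v1 j + B * v2 j + c * v3 j + d * v4 j = 0) ->
  (forall j, A * v1 j + B * v2 j + c' * v5 j + d' * v6 j = 0) ->
  B * (grad_det v2 v3 v4 * grad_det v1 v5 v6 - grad_det v1 v3 v4 * grad_det v2 v5 v6) = 0.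
Proof.
have key u1 u2 u3 u4 (e f : C) : (forall j, A * u1 j + B * u2 j + e * u3 j + f * u4 j = 0) ->
    B * grad_det u2 u3 u4 = - A * grad_det u1 u3 u4.
  move=> rel; apply/eqP; rewrite -subr_eq0; apply/eqP.
  have <- : grad_det (fun j => A * u1 j + B * u2 j + e * u3 j + f * u4 j) u3 u4 = 0.
    exact: grad_det0.
  by rewrite /grad_det; ring.
move=> /key r1 /key r2.
rewrite mulrBr mulrA r1 [X in _ - X]mulrCA r2; ring.
Qed.

(** The point Z + i t with t = - 4 ln q / pi, so that q = exp (- pi t / 4). *)
Definition deform Z (q : R) : 'M[C]_3 := Z + (0 +i* (- (4 * ln q / pi)))%:M.

Definition norm2 x : nat := (\sum_i absz (x i 0%R) ^ 2)%N.

Lemma norm2E (F : numDomainType) x : (norm2 x)%:R = \sum_i (x i 0)%:~R ^+ 2 :> F.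
Proof.
rewrite /norm2 natr_sum; apply: eq_bigr => i _.
by rewrite natrX natr_absz intr_norm real_normK// realz.
Qed.

Lemma deform1 Z : deform Z 1 = Z.
Proof.
rewrite /deform ln1 mulr0 mul0r oppr0.
by apply/matrixP => i j; rewrite !mxE mul0rn addr0.
Qed.

Lemma siegel_deform Z q : 0 < q <= 1 -> siegel_upper_half_space3 Z ->
  siegel_upper_half_space3 (deform Z q).
Proof.
move=> /andP[q0 q1] [ZT Zpos]; split; first by rewrite linearD/= ZT tr_scalar_mx.
move=> x x0; have := Zpos x x0.
set t : R := - (4 * ln q / pi).
have t0 : 0 <= t.
  rewrite /t -mulNr divr_ge0 ?pi_ge0// oppr_ge0 mulr_ge0_le0//; exact: ln_le0.
have -> : map_mx (@complex.Im R) (deform Z q) = map_mx (@complex.Im R) Z + t%:M.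
  apply/matrixP => i j; rewrite !mxE; case: (Z i j) => u v.
  by case: (i == j); rewrite ?mulr1n ?mulr0n /= ?addr0.
rewrite mulmxDr mulmxDl mul_mx_scalar -scalemxAl => h.
set P := x^T *m _ *m x in h *; set Q := x^T *m x.
have -> : (P + t *: Q) 0 0 = P 0 0 + t * Q 0 0 by rewrite !mxE.
rewrite ltr_pwDl// mulr_ge0// /Q mxE sumr_ge0// => i _.
by rewrite !mxE -expr2 sqr_ge0.
Qed.

(** The quadratic form changes by i t |x|^2, which multiplies the term by
    exp (- pi t |x|^2 / 4) = q ^ |x|^2. *)
Lemma theta_term_deform Z a b n q : 0 < q ->
  theta_term (deform Z q) a b 0 n =
  theta_term Z a b 0 n * (q ^+ norm2 (n *+ 2 + b))%:C.
Proof.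
move=> q0; set x := n *+ 2 + b; rewrite /theta_term -/x.
set t : R := - (4 * ln q / pi).
have -> : (q ^+ norm2 x)%:C = cexp (- (pi * (t * (norm2 x)%:R / 4)))%:C.
  rewrite cexp_real; congr (_%:C).
  rewrite -{1}(lnK q0) -expRM_natl; congr expR.
  have pi0 : pi != 0 :> R by rewrite gt_eqF ?pi_gt0.
  by rewrite /t; move: (@pi R) pi0 => p p0; field.
rewrite -cexpD; congr cexp; rewrite /phase.
have -> : qform (deform Z q) x x = qform Z x x + (0 +i* t) * (norm2 x)%:R.
  by rewrite /deform -/t qform_add_scalar norm2E.
have -> : (- (pi * (t * (norm2 x)%:R / 4)))%:C = ipi R * ((0 +i* t) * (norm2 x)%:R / 4).
  have -> : 0 +i* t = 'i%C * t%:C.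
    by apply/eqP; rewrite eq_complex/=; apply/andP; split; apply/eqP; ring.
  have -> : ipi R = 'i%C * pi%:C.
    by apply/eqP; rewrite eq_complex/=; apply/andP; split; apply/eqP; ring.
  rewrite rmorphN !rmorphM fmorphV !rmorph_nat.
  have ii : 'i%C * 'i%C = -1 :> C by rewrite -expr2 sqr_i.
  transitivity (('i%C * 'i%C) * (pi%:C * (t%:C * (norm2 x)%:R / 4))); last by ring.
  by rewrite ii mulN1r.
move: (qform Z x x) (pairing x 0) (dotz a x)%:~R (norm2 x)%:R (0 +i* t) (ipi R) => *.
by field.
Qed.

Lemma power_series_grad Z c j : siegel_upper_half_space3 Z ->
  is_power_series (fun q => grad_char (deform Z q) c j).
Proof.
move=> hZ.
apply: (power_seriesI (k := fun n => norm2 (n *+ 2 + bitvec c.2))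
  (abs_summable_theta_grad (bitvec c.1) (bitvec c.2) j hZ)) => q q01.
have := theta_grad_has_sum (bitvec c.1) (bitvec c.2) j (siegel_deform q01 hZ).
congr (has_sum _ _); apply/funext => n; rewrite theta_term_deform; first by rewrite mulrAC.
by case/andP: q01.
Qed.

Lemma power_seriesN (f : R -> C) : is_power_series f -> is_power_series (fun q => - f q).
Proof.
move=> fw; rewrite (_ : (fun _ => _) = fun q => (-1) * f q).
  by apply: power_seriesM fw; exact: power_series_cst.
by apply/funext => q; rewrite mulN1r.
Qed.

Lemma power_series_grad_det (V1 V2 V3 : R -> 'I_3 -> C) :
  (forall j, is_power_series (fun q => V1 q j)) -> (forall j, is_power_series (fun q => V2 q j)) ->
  (forall j, is_power_series (fun q => V3 q j)) ->
  is_power_series (fun q => grad_det (V1 q) (V2 q) (V3 q)).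
Proof.
move=> W1 W2 W3.
have minor i j : is_power_series (fun q => V2 q i * V3 q j - V2 q j * V3 q i).
  by apply: (power_seriesD (power_seriesM (W2 i) (W3 j)) (power_seriesN (power_seriesM (W2 j) (W3 i)))).
exact: (power_seriesD (power_seriesD (power_seriesM (W1 0) (minor 1 2%:R)) 
  (power_seriesN (power_seriesM (W1 1) (minor 0 2%:R))))
  (power_seriesM (W1 2%:R) (minor 0 1))).
Qed.

Lemma power_series_jac Z c1 c2 c3 : siegel_upper_half_space3 Z ->
  is_power_series (fun q => jac (deform Z q) c1 c2 c3).
Proof. by move=> hZ; apply: power_series_grad_det => j; exact: power_series_grad. Qed.

(** If the terms with |x|^2 = m add up to something nonzero, the series in [q]
    has a nonzero coefficient. *)
Lemma theta_deform_nonzero Z c m (w : C) : siegel_upper_half_space3 Z -> w != 0 ->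
  has_sum (fun n => theta_term Z (bitvec c.1) (bitvec c.2) 0 n *
     (norm2 (n *+ 2 + bitvec c.2) == m)%:R) w ->
  exists2 d : R, 0 < d & forall q, 0 < q < d -> theta_char (deform Z q) c 0 != 0.
Proof.
move=> hZ w0 hw.
have hq q : 0 < q <= 1 -> has_sum (fun n => theta_term Z (bitvec c.1) (bitvec c.2) 0 n *
    (q ^+ norm2 (n *+ 2 + bitvec c.2))%:C) (theta_char (deform Z q) c 0).
  move=> q01; have := theta_int_has_sum (bitvec c.1) (bitvec c.2) 0 (siegel_deform q01 hZ).
  congr (has_sum _ _); apply/funext => n; rewrite theta_term_deform//.
  by case/andP: q01.
have [x [xS xf xm]] := power_series_coefs (abs_summable_theta_term (bitvec c.1) (bitvec c.2) 0 hZ) hq.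
apply: (power_series_nonzero xS xf (m := m)).
by rewrite (has_sum_unique (xm m) hw).
Qed.

Lemma norm2_sum3 x :
  norm2 x = (absz (x 0%R 0%R) ^ 2 + absz (x 1%R 0%R) ^ 2 + absz (x 2%:R%R 0%R) ^ 2)%N.
Proof.
rewrite /norm2 !big_ord_recl big_ord0 addn0 addnA.
by congr (absz (x _ _) ^ 2 + absz (x _ _) ^ 2 + absz (x _ _) ^ 2)%N; exact: val_inj.
Qed.

Lemma lattice_eq0P n : n 0 0 = 0 -> n 1 0 = 0 -> n 2%:R 0 = 0 -> n = 0.
Proof. by move=> n0 n1 n2; apply/matrixP => i j; rewrite ord1 [RHS]mxE; elim/ord3P: i. Qed.

(** Here x runs over the even vectors, and x = 0 gives the lowest term. *)
Lemma theta_deform_nonzero0 Z (u : bits) : siegel_upper_half_space3 Z ->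
  exists2 d : R, 0 < d &
    forall q, 0 < q < d -> theta_char (deform Z q) (u, (false, false, false)) 0 != 0.
Proof.
move=> hZ; set b := bitvec (false, false, false).
have b0 : b = 0 by apply: lattice_eq0P; rewrite mxE.
apply: (@theta_deform_nonzero Z _ 0%N (theta_term Z (bitvec u) b 0 0)) => //.
  exact: cexp_neq0.
rewrite -/b b0 /=; have := @has_sum_delta R _ (0 : lattice) (theta_term Z (bitvec u) 0 0 0).
congr (has_sum _ _); apply/funext => n; rewrite addr0.
have -> : (norm2 (n *+ 2) == 0%N) = (n == 0).
  apply/eqP/eqP => [|->]; last by rewrite mul0rn norm2_sum3 !mxE.
  rewrite norm2_sum3 mulr2n !mxE => /eqP; rewrite !addn_eq0 !expn_eq0 /= !andbT !absz_eq0.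
  rewrite -!mulr2n !mulrn_eq0/= => /andP[/andP[/eqP n0 /eqP n1] /eqP n2].
  exact: lattice_eq0P.
by case: eqP => [->//|_]; rewrite !mulr0.
Qed.

Lemma norm2_eq1 (x y z : int) :
  (absz (x * 2)%R ^ 2 + absz (y * 2)%R ^ 2 + absz (z * 2 + 1)%R ^ 2 = 1)%N ->
  [/\ x = 0, y = 0 & z = 0 \/ z = -1].
Proof.
move=> E.
have z1 : (1 <= absz (z * 2 + 1)%R ^ 2)%N by rewrite expn_gt0; apply/orP; left; lia.
move: E z1; set X := (absz (x * 2)%R ^ 2)%N; set Y := (absz (y * 2)%R ^ 2)%N.
set W := (absz (z * 2 + 1)%R ^ 2)%N => E W1.
have X0 : X == 0%N by apply/eqP; clearbody X Y W; lia.
have Y0 : Y == 0%N by apply/eqP; clearbody X Y W; lia.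
have W0 : W == (1 ^ 2)%N by apply/eqP; rewrite exp1n; clearbody X Y W; lia.
move: X0 Y0 W0; rewrite /X /Y /W !expn_eq0 !andbT eqn_sqr.
by move=> /eqP x0 /eqP y0 /eqP z0; split; lia.
Qed.

(** In the coset of a unit vector e modulo 2, the shortest vectors are e and
    - e. *)
Lemma shortest_odd_vectors (v : bits) n :
  v = (false, false, true) \/ v = (false, true, false) ->
  norm2 (n *+ 2 + bitvec v) = 1%N -> n = 0 \/ n = - bitvec v.
Proof.
have m2 (k : int) : k + k = k * 2 by ring.
move=> [->|->]; rewrite norm2_sum3 mulr2n !mxE /= !addr0 !m2.
  move=> /norm2_eq1[n0 n1 [n2|n2]]; [left|right].
    exact: lattice_eq0P.
  by apply/matrixP => i j; rewrite ord1 !mxE; elim/ord3P: i; rewrite ?n0 ?n1 ?n2.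
rewrite addnAC => /norm2_eq1[n0 n2 [n1|n1]]; [left|right].
  exact: lattice_eq0P.
by apply/matrixP => i j; rewrite ord1 !mxE; elim/ord3P: i; rewrite ?n0 ?n1 ?n2.
Qed.

(** The terms at e and - e are equal because the characteristic is even. *)
Lemma theta_deform_nonzero1 Z (u v : bits) : siegel_upper_half_space3 Z ->
  v = (false, false, true) \/ v = (false, true, false) -> ~~ odd_char (u, v) ->
  exists2 d : R, 0 < d & forall q, 0 < q < d -> theta_char (deform Z q) (u, v) 0 != 0.
Proof.
move=> hZ vE uv; set b := bitvec v.
pose T0 := theta_term Z (bitvec u) b 0 0.
have Tb : theta_term Z (bitvec u) b 0 (- b) = T0.
  have -> : - b = - 0 - b by rewrite oppr0 sub0r.
  rewrite theta_term_opp (@zeta8_eq R _ 0 (dot3 (of_bits u) (of_bits v) %/ 2)%Z).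
    by rewrite zeta8_0 mul1r.
  have E : dot3 (of_bits u) (of_bits v) =
    (dot3 (of_bits u) (of_bits v) %/ 2)%Z * 2 + (odd_char (u, v) : nat)%:Z := dot3_parity (u, v).
  rewrite (negbTE uv) addr0 in E.
  by rewrite /b !bitvec_vec3 dotz_vec3 {1}E; ring.
have b0 : 0 != - b.
  rewrite eq_sym oppr_eq0 /b; apply/eqP => /matrixP bE.
  by case: vE bE => [-> /(_ 2%:R 0)|-> /(_ 1 0)]; rewrite !mxE.
have nb : norm2 b = 1%N by rewrite norm2_sum3 /b; case: vE => ->; rewrite !mxE.
have nNb : norm2 (- b *+ 2 + b) = 1%N.
  rewrite (_ : - b *+ 2 + b = - b); last by lattice_eq.
  by apply: etrans nb; rewrite !norm2_sum3 !mxE !abszN.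
apply: (@theta_deform_nonzero Z _ 1%N (T0 + T0)) => //.
  by rewrite -mulr2n mulrn_eq0 cexp_neq0.
rewrite /= -/b.
have := has_sumD (@has_sum_delta R _ (0 : lattice) T0) (@has_sum_delta R _ (- b) T0).
congr (has_sum _ _); apply/funext => n /=.
have [->|n0] := eqVneq n 0.
  by rewrite mul0rn add0r nb (negbTE b0) eqxx mulr0 addr0.
have [->|nb'] := eqVneq n (- b).
  by rewrite nNb eqxx Tb mulr0 add0r.
rewrite !mulr0 addr0; case: eqP; last by rewrite mulr0.
by move=> /(shortest_odd_vectors vE)[|] /eqP; rewrite ?(negbTE n0) ?(negbTE nb').
Qed.

(** The factors of B have characteristics whose second row is 0 or a unit
    vector, so B does not vanish for small [q]. *)
Lemma jac_identity Z : siegel_upper_half_space3 Z ->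
  let w1 := ch 1 0 1 0 0 1 in let w2 := ch 1 1 0 0 1 1 in
  let w3 := ch 1 1 1 0 1 0 in let w3' := ch 0 1 1 0 1 0 in
  let w7 := ch 0 0 1 1 1 1 in let w7' := ch 1 1 0 1 0 1 in
  jac Z w2 w3 w7 * jac Z w1 w3' w7' = jac Z w1 w3 w7 * jac Z w2 w3' w7'.
Proof.
move=> hZ w1 w2 w3 w3' w7 w7'.
pose X q := jac (deform Z q) w2 w3 w7 * jac (deform Z q) w1 w3' w7'
  - jac (deform Z q) w1 w3 w7 * jac (deform Z q) w2 w3' w7'.
have XW : is_power_series X.
  exact: (power_seriesD (power_seriesM (power_series_jac w2 w3 w7 hZ) (power_series_jac w1 w3' w7' hZ))
    (power_seriesN (power_seriesM (power_series_jac w1 w3 w7 hZ) (power_series_jac w2 w3' w7' hZ)))).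
have [d1 d10 t1] := @theta_deform_nonzero1 Z (false, false, false) (false, false, true) hZ
  (or_introl erefl) isT.
have [d2 d20 t2] := @theta_deform_nonzero1 Z (false, false, true) (false, true, false) hZ
  (or_intror erefl) isT.
have [d3 d30 t3] := @theta_deform_nonzero0 Z (true, true, true) hZ.
suff : X 1 = 0 by rewrite /X deform1 => /eqP; rewrite subr_eq0 => /eqP.
have d0 : 0 < Num.min (Num.min 1 d1) (Num.min d2 d3) by rewrite !lt_min ltr01 d10 d20.
apply: (power_series_identity XW d0) => q /andP[q0]; rewrite !lt_min.
move=> /andP[/andP[q1 qd1] /andP[qd2 qd3]].
have hq : siegel_upper_half_space3 (deform Z q) by apply: siegel_deform; rewrite ?q0 ?ltW.
have [c [d r1]] := coplanar_w1_w2_w3_w7 hq.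
have [c' [d' r2]] := coplanar_w1_w2_w3'_w7' hq.
have /eqP := concurrent_lines r1 r2.
rewrite !mulf_eq0 (negbTE (t1 _ _)) ?q0// (negbTE (t2 _ _)) ?q0// (negbTE (t3 _ _)) ?q0//.
by move=> /eqP.
Qed.

Lemma grad_char_shift Z s c j : siegel_upper_half_space3 Z ->
  let e := (false, false, false) in
  grad_char (Z - map_mx intr (symmx s)) c j =
  zeta8 R (shift_exp s c e) * grad_char Z (shift_char s c e) j.
Proof.
move=> hZ e.
have hZ' := siegel_untranslate s hZ.
apply: (expansion1_uniq (theta_char_expansion c j hZ')).
have e0 : bitvec e = 0 by apply: lattice_eq0P; rewrite mxE.
have E h : theta_char (Z - map_mx intr (symmx s)) c (h *: delta_mx j 0) =
    zeta8 R (shift_exp s c e) * theta_char Z (shift_char s c e) (h *: delta_mx j 0).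
  by have := theta_shift s c e (h *: delta_mx j 0) hZ; rewrite e0 addr0.
rewrite (_ : (fun h => _) = fun h => zeta8 R (shift_exp s c e) *
  theta_char Z (shift_char s c e) (h *: delta_mx j 0)); last exact/funext.
have := expansion1M (expansion1_cst (zeta8 R (shift_exp s c e)))
  (theta_char_expansion (shift_char s c e) j hZ).
by rewrite mul0r add0r.
Qed.

Lemma jac_shift Z s c1 c2 c3 : siegel_upper_half_space3 Z ->
  let e := (false, false, false) in
  jac (Z - map_mx intr (symmx s)) c1 c2 c3 =
  zeta8 R (shift_exp s c1 e) * zeta8 R (shift_exp s c2 e) * zeta8 R (shift_exp s c3 e) *
  jac Z (shift_char s c1 e) (shift_char s c2 e) (shift_char s c3 e).
Proof.
move=> hZ e; rewrite /jac /grad_det !grad_char_shift//.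
move: (zeta8 _ _) (zeta8 _ _) (zeta8 _ _) => u1 u2 u3.
rewrite -/e.
move: (grad_char Z (shift_char s c1 e)) (grad_char Z (shift_char s c2 e))
  (grad_char Z (shift_char s c3 e)) => v1 v2 v3; ring.
Qed.

Lemma cancel_scalars (u1 u2 u3 u4 u5 u6 x y z t : C) :
  u1 != 0 -> u2 != 0 -> u3 != 0 -> u4 != 0 -> u5 != 0 -> u6 != 0 ->
  (u2 * u3 * u5 * x) * (u1 * u4 * u6 * y) = (u1 * u3 * u5 * z) * (u2 * u4 * u6 * t) ->
  t * z = y * x.
Proof.
move=> h1 h2 h3 h4 h5 h6 rel.
have u0 : u1 * u2 * u3 * u4 * u5 * u6 != 0 by rewrite !mulf_neq0.
apply: (mulfI u0).
transitivity ((u1 * u3 * u5 * z) * (u2 * u4 * u6 * t)); first by ring.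
by rewrite -rel; ring.
Qed.

(** Translation by E_11 sends w1, w2, w3, w3' to w1', w2', w3', w3 and fixes
    w7, w7'.  The constants cancel because both sides contain the same six
    characteristics. *)
Lemma jac_identity' Z : siegel_upper_half_space3 Z ->
  let w1' := ch 0 0 1 0 0 1 in let w2' := ch 0 1 0 0 1 1 in
  let w3 := ch 1 1 1 0 1 0 in let w3' := ch 0 1 1 0 1 0 in
  let w7 := ch 0 0 1 1 1 1 in let w7' := ch 1 1 0 1 0 1 in
  jac Z w2' w3 w7' * jac Z w1' w3' w7 = jac Z w1' w3 w7' * jac Z w2' w3' w7.
Proof.
move=> hZ w1' w2' w3 w3' w7 w7'.
pose s : symdata := ((1, 0, 0), (0, 0, 0)).
pose w1 := ch 1 0 1 0 0 1; pose w2 := ch 1 1 0 0 1 1.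
pose e := (false, false, false).
have z0 c := zeta8_neq0 R (shift_exp s c e).
have S c1 c2 c3 := jac_shift s c1 c2 c3 hZ.
have := jac_identity (siegel_untranslate s hZ).
rewrite -/w1 -/w2 -/w3 -/w3' -/w7 -/w7' /=.
rewrite (S w2 w3 w7) (S w1 w3' w7') (S w1 w3 w7) (S w2 w3' w7') -/e.
have -> : shift_char s w1 e = w1' by vm_compute.
have -> : shift_char s w2 e = w2' by vm_compute.
have -> : shift_char s w3 e = w3' by vm_compute.
have -> : shift_char s w3' e = w3 by vm_compute.
have -> : shift_char s w7 e = w7 by vm_compute.
have -> : shift_char s w7' e = w7' by vm_compute.
exact: (cancel_scalars (z0 w1) (z0 w2) (z0 w3) (z0 w3') (z0 w7) (z0 w7')).
Qed.

End JacobianNullwerte.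

Lemma characteristic_ofE (R : realType) (a1 a2 a3 b1 b2 b3 : bool) :
  let h (e : bool) : R[i] := if e then 1 / 2 else 0 in
  (col3 (h a1) (h a2) (h a3), col3 (h b1) (h b2) (h b3)) =
  characteristic_of R ((a1, a2, a3), (b1, b2, b3)).
Proof.
have E (x y z : bool) : col3 (if x then 1 / 2 else 0) (if y then 1 / 2 else 0)
    (if z then 1 / 2 else 0) = halfchar R (bitvec (x, y, z)).
  apply/matrixP => i j; rewrite !mxE.
  by elim/ord3P: i => /=; case: ifP => _; rewrite ?mul0r.
by rewrite /characteristic_of !E.
Qed.

Lemma scale_products (F : comNzRingType) (p a b c d : F) :
  a * b = c * d -> (p * a) * (p * b) = (p * c) * (p * d).
Proof. by move=> abcd; rewrite mulrACA abcd mulrACA. Qed.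

Lemma zero_products (F : comNzRingType) (x1 x2 x3 y1 y2 y3 u v : F) :
  u = 0 -> v = 0 -> x1 * x2 * (x3 * u) = y1 * v * (y2 * y3).
Proof. by move=> -> ->; rewrite !mulr0 mul0r. Qed.

Theorem theorem1p2 (R : realType) (Z : 'M[R[i]]_3)
    (hZ : siegel_upper_half_space3 Z) :
  let h : R[i] := 1 / 2 in
  let w1  : characteristic R := (col3 h 0 h, col3 0 0 h) in
  let w1' : characteristic R := (col3 0 0 h, col3 0 0 h) in
  let w2  : characteristic R := (col3 h h 0, col3 0 h h) in
  let w2' : characteristic R := (col3 0 h 0, col3 0 h h) in
  let w3  : characteristic R := (col3 h h h, col3 0 h 0) in
  let w3' : characteristic R := (col3 0 h h, col3 0 h 0) in
  let w4  : characteristic R := (col3 h 0 0, col3 h h h) in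
  let w4' : characteristic R := (col3 0 0 0, col3 h h h) in
  let w7  : characteristic R := (col3 0 0 h, col3 h h h) in
  let w7' : characteristic R := (col3 h h 0, col3 h 0 h) in
  let J u1 u2 u3 := jacobian_nullwert u1 u2 u3 Z in
  [/\ J w2 w3 w7 * J w1 w3' w7' = J w1 w3 w7 * J w2 w3' w7',
      J w2' w3 w7' * J w1' w3' w7 = J w1' w3 w7' * J w2' w3' w7,
      J w3 w1 w2 * J w3' w1 w2 * (J w4 w1 w2' * J w4' w1 w2')
        = J w4 w1 w2 * J w4' w1 w2 * (J w3 w1 w2' * J w3' w1 w2'),
      J w3 w1 w2 * J w3' w1 w2 * (J w4 w2 w1' * J w4' w2 w1')
        = J w4 w1 w2 * J w4' w1 w2 * (J w3 w2 w1' * J w3' w2 w1')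
    & J w3 w1 w2 * J w3' w1 w2 * (J w4 w1' w2' * J w4' w1' w2')
        = J w4 w1 w2 * J w4' w1 w2 * (J w3 w1' w2' * J w3' w1' w2')].
Proof.
move=> h w1 w1' w2 w2' w3 w3' w4 w4' w7 w7' J.
have -> : w1 = characteristic_of R (ch 1 0 1 0 0 1)
  := characteristic_ofE R true false true false false true.
have -> : w1' = characteristic_of R (ch 0 0 1 0 0 1)
  := characteristic_ofE R false false true false false true.
have -> : w2 = characteristic_of R (ch 1 1 0 0 1 1)
  := characteristic_ofE R true true false false true true.
have -> : w2' = characteristic_of R (ch 0 1 0 0 1 1)
  := characteristic_ofE R false true false false true true.
have -> : w3 = characteristic_of R (ch 1 1 1 0 1 0)
  := characteristic_ofE R true true true false true false.
have -> : w3' = characteristic_of R (ch 0 1 1 0 1 0)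
  := characteristic_ofE R false true true false true false.
have -> : w4 = characteristic_of R (ch 1 0 0 1 1 1)
  := characteristic_ofE R true false false true true true.
have -> : w4' = characteristic_of R (ch 0 0 0 1 1 1)
  := characteristic_ofE R false false false true true true.
have -> : w7 = characteristic_of R (ch 0 0 1 1 1 1)
  := characteristic_ofE R false false true true true true.
have -> : w7' = characteristic_of R (ch 1 1 0 1 0 1)
  := characteristic_ofE R true true false true false true.
have JE c1 c2 c3 : J (characteristic_of R c1) (characteristic_of R c2) (characteristic_of R c3)
    = (pi%:C)%C ^+ 3 * jac Z c1 c2 c3 by exact: jacobian_nullwertE.
have J4 c2 c3 : J (characteristic_of R (ch 0 0 0 1 1 1)) (characteristic_of R c2)
    (characteristic_of R c3) = 0 by rewrite JE jac_even// mulr0.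
split.
- by rewrite !JE; exact: scale_products (jac_identity hZ).
- by rewrite !JE; exact: scale_products (jac_identity' hZ).
- by apply: zero_products; exact: J4.
- by apply: zero_products; exact: J4.
- by apply: zero_products; exact: J4.
Qed.
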